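(* There is a constant $C>0$ such that for all $d\geq 2$, the Glauber dynamics chain $\mathcal{M}_3(Q_d)$ on proper $3$-colourings of the hypercube $Q_d$ satisfies $$\tau_{\mathcal{M}_3(Q_d)} \geq \exp_2\left\{\frac{C2^d}{\sqrt{d}\,\log d}\right\}.$$
   Context: $\log=\log_2$ and $\exp_2 x=2^x$. $Q_d$ is the $d$-dimensional hypercube: the graph on vertex set $V=\{0,1\}^d$ in which two strings are adjacent iff they differ on exactly one coordinate. $\mathcal{C}_3=\mathcal{C}_3(Q_d)$ is the set of proper $3$-colourings $\chi:V\to\{0,1,2\}$ of $Q_d$, and $\pi_3$ is the uniform distribution on $\mathcal{C}_3$. Glauber dynamics $\mathcal{M}_3(Q_d)$ is the Markov chain on $\mathcal{C}_3$ with transition probabilities $P_3(\chi_1,\chi_2)=0$ if $\chi_1,\chi_2$ differ on more than one vertex, $P_3(\chi_1,\chi_2)=\frac{1}{3|V|}$ if they differ on exactly one vertex, and $P_3(\chi_1,\chi_1)=1-\sum_{\chi'\neq\chi_1}P_3(\chi_1,\chi')$. The mixing time is $\tau_{\mathcal{M}_3}=\min\{t: d_{TV}(P_3^t,\pi_3)\leq 1/e\}$, where $P_3^t$ is the $t$-step transition probability and $d_{TV}(P_3^t,\pi_3)=\max_{\chi_1\in\mathcal{C}_3}\frac12\sum_{\chi_2\in\mathcal{C}_3}|P_3^t(\chi_1,\chi_2)-\pi_3(\chi_2)|$. *)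

(* Defs.v *)
From HB Require Import structures.
From mathcomp Require Import all_boot all_order all_algebra.
From mathcomp Require Import all_classical all_reals all_analysis.

Set Implicit Arguments.
Unset Strict Implicit.
Unset Printing Implicit Defensive.

Import Order.TTheory GRing.Theory Num.Theory.
Local Open Scope ring_scope.

Definition log2 {R : realType} (x : R) : R := ln x / ln 2.

Definition exp2 {R : realType} (x : R) : R := 2 `^ x.

(** ** Finite Markov chains *)

Section MarkovChain.
Variables (R : realType) (S : finType).
Implicit Types (P : S -> S -> R) (mu : S -> R).

Fixpoint step_prob P (t : nat) (x y : S) : R :=
  if t is t'.+1 then \sum_(z : S) step_prob P t' x z * P z y
  else (x == y)%:R.

(* The default value 0 of the maximum only matters when S is empty, since the
   quantities compared are nonnegative. *)
Definition tv_dist P (t : nat) mu : R :=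
  \big[Num.max/0]_(x : S) (2^-1 * \sum_(y : S) `|step_prob P t x y - mu y|).

(* The least t such that the distance is at most 1/e, as an extended real:
   the infimum is a minimum as soon as such a t exists (mixing_time_min), and
   is +oo otherwise. *)
Definition mixing_time P mu : \bar R :=
  ereal_inf [set (t%:R : R)%:E | t in [set t | tv_dist P t mu <= expR (-1)]].

Lemma mixing_time_min P mu (t : nat) :
  tv_dist P t mu <= expR (-1) ->
  (forall s : nat, tv_dist P s mu <= expR (-1) -> (t <= s)%N) ->
  mixing_time P mu = (t%:R : R)%:E.
Proof.
move=> tP tmin; apply/eqP; rewrite eq_le; apply/andP; split.
  by apply: ereal_inf_lbound; exists t.
apply: le_ereal_inf_tmp => _ [s /= sP <-].
by rewrite lee_fin ler_nat tmin.
Qed.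

Definition uniform_dist : S -> R := fun _ => #|S|%:R^-1.

End MarkovChain.

(** ** Glauber dynamics on the proper 3-colourings of a finite graph *)

Section Glauber.
Variables (R : realType) (V : finType) (adj : rel V).

Definition proper_colouring (chi : {ffun V -> 'I_3}) : bool :=
  [forall u, forall v, adj u v ==> (chi u != chi v)].

Definition colouring3 : finType := {chi : {ffun V -> 'I_3} | proper_colouring chi}.

Definition num_diff (chi1 chi2 : colouring3) : nat :=
  #|[set v | val chi1 v != val chi2 v]|.

Definition glauber_offdiag (chi1 chi2 : colouring3) : R :=
  if num_diff chi1 chi2 == 1%N then (3 * #|V|%:R)^-1 else 0.

Definition glauber (chi1 chi2 : colouring3) : R :=
  if chi1 == chi2 then 1 - \sum_(chi | chi != chi1) glauber_offdiag chi1 chi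
  else glauber_offdiag chi1 chi2.

Definition glauber_mixing_time : \bar R :=
  mixing_time glauber (@uniform_dist R colouring3).

End Glauber.

(** ** The hypercube *)

Definition cube (d : nat) : finType := {ffun 'I_d -> bool}.

Definition cube_adj (d : nat) : rel (cube d) :=
  fun x y => #|[set i | x i != y i]| == 1%N.

(* Main.v *)
Require Import Defs.
From mathcomp Require Import all_boot all_order all_algebra.
From mathcomp Require Import all_classical all_reals all_analysis.
From mathcomp Require Import ring lra zify.
From mathcomp Require Import fintype finset.

(** Let [N = 2^(d-1)] be the number of odd vertices.  Call an odd vertex
    monochrome when its neighbours all have the same colour; only those can be
    recoloured freely once the even vertices are coloured.  One update changes
    the number of monochrome vertices by at most [d], so colourings with about
    [N/2] of them separate two sets of at least [2^(N-1)] colourings each, and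
    it suffices to show that there are at most
    [2^N exp(- c N / (sqrt d ln d))] colourings in this bottleneck.

    Call an odd vertex nearly monochrome when its neighbourhood is not
    monochrome but has one colour up to at most [d/8] exceptions, and let
    [m0] be of order [N / (sqrt d ln d)].  If there are more than [m0] such
    vertices, weight every one by [4/3] and apply Finner's inequality (the
    neighbourhoods of the odd vertices cover each even vertex [d] times): the
    weighted count stays [2^(N + O(N/d))], because a nearly monochrome
    neighbourhood is exponentially unlikely.  If there are at most [m0], then
    revealing the colours of [O(m0 + N ln d / d)] vertices determines the set
    [A] of the remaining monochrome vertices and the colours on its
    neighbourhood [N(A)]; there are then only [2^(|A| + N - |N(A)|)]
    completions, and isoperimetry gives [|N(A)| - |A| >= c N / sqrt d]. *)

Set Implicit Arguments.
Unset Strict Implicit.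
Unset Printing Implicit Defensive.

Import Order.TTheory GRing.Theory Num.Theory.
Local Open Scope ring_scope.

Lemma ler_sum_subset (R : numDomainType) (I : finType) (A : pred I) (F : I -> R) :
  (forall i, 0 <= F i) -> \sum_(i | A i) F i <= \sum_i F i.
Proof. by move=> F0; rewrite [leRHS](bigID A) /= lerDl sumr_ge0. Qed.

Definition recolour (V : finType) (S : Type) (f : {ffun V -> S}) (v : V) (c : S) :
    {ffun V -> S} :=
  [ffun u => if u == v then c else f u].

(** * Bottlenecks of symmetric Markov chains *)

Section Bottleneck.
Variables (R : realType) (S : finType) (P : S -> S -> R).
Hypothesis P_ge0 : forall x y, 0 <= P x y.
Hypothesis P_row : forall x, \sum_y P x y = 1.
Hypothesis P_sym : forall x y, P x y = P y x.

Lemma step_prob_ge0 t x y : 0 <= step_prob P t x y.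
Proof.
elim: t y => [|t IH] y /=; first exact: ler0n.
by apply: sumr_ge0 => z _; apply: mulr_ge0.
Qed.

Lemma step_prob_row t x : \sum_y step_prob P t x y = 1.
Proof.
elim: t => [|t IH] /=.
  rewrite (bigD1 x) //= eqxx big1 ?addr0 // => y.
  by rewrite eq_sym => /negbTE ->.
rewrite exchange_big /= -[RHS]IH; apply: eq_bigr => z _.
by rewrite -mulr_sumr P_row mulr1.
Qed.

Lemma step_prob_col t y : \sum_x step_prob P t x y = 1.
Proof.
elim: t y => [|t IH] y /=.
  rewrite (bigD1 y) //= eqxx big1 ?addr0 // => x /negbTE.
  by move=> ->.
rewrite exchange_big /= -[RHS](P_row y); apply: eq_bigr => z _.
by rewrite -mulr_suml IH mul1r P_sym.
Qed.

Definition exit_boundary (A : {set S}) : {set S} :=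
  [set x in A | [exists y, (y \notin A) && (P x y != 0)]].

(** Start one unit of mass at every point of [A]. The chain is doubly stochastic, so no point ever
    carries more than one unit; in each step mass leaves [A] only through [exit_boundary A], at most
    one unit per point. *)
Lemma escape_mass_le (A : {set S}) t :
  \sum_(x in A) \sum_(y in ~: A) step_prob P t x y <= t%:R * #|exit_boundary A|%:R.
Proof.
elim: t => [|t IH] /=.
  rewrite mul0r big1 // => x xA; rewrite big1 // => y; rewrite inE => yA.
  by case: eqP => // xy; rewrite -xy xA in yA.
have out_le z : \sum_(y in ~: A) P z y <= 1.
  by rewrite -(P_row z) ler_sum_subset.
rewrite (_ : \sum_(x in A) _ =
    \sum_z (\sum_(x in A) step_prob P t x z) * (\sum_(y in ~: A) P z y)); last first.
  under eq_bigr do rewrite exchange_big /=.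
  rewrite exchange_big /=; apply: eq_bigr => z _.
  rewrite mulr_suml; apply: eq_bigr => x _.
  by rewrite mulr_sumr.
have colA z : 0 <= \sum_(x in A) step_prob P t x z <= 1.
  rewrite sumr_ge0 /=; last by move=> x _; exact: step_prob_ge0.
  by rewrite -(step_prob_col t z) ler_sum_subset // => x; exact: step_prob_ge0.
rewrite (bigID (mem (~: A))) /= -natr1 mulrDl mul1r.
apply: lerD.
  apply: le_trans IH; rewrite exchange_big /=; apply: ler_sum => z _.
  by rewrite ler_piMr // ?out_le //; case/andP: (colA z).
rewrite (bigID (mem (exit_boundary A))) /= [X in _ + X]big1 ?addr0.
  rewrite -sum1_card natr_sum.
  rewrite [X in X <= _](_ : _ = \sum_(z in exit_boundary A)
      (\sum_(x in A) step_prob P t x z) * (\sum_(y in ~: A) P z y)).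
    apply: ler_sum => z _; case/andP: (colA z) => c0 c1.
    by rewrite mulr_ile1 // ?out_le // sumr_ge0.
  apply: eq_bigl => z; rewrite !inE negbK; by case: (z \in A).
move=> z; rewrite !inE negbK => /andP[zA]; rewrite zA /= negb_exists => /forallP H.
rewrite [X in _ * X]big1 ?mulr0 // => y; rewrite inE => yA.
by have := H y; rewrite yA /= negbK => /eqP.
Qed.

(** The difference of the two distributions has total mass 0, so twice its mass on [A] is at most
    its l1 norm. *)
Lemma tv_dist_ge (mu : S -> R) t x (A : {set S}) :
  \sum_y mu y = 1 ->
  \sum_(y in A) step_prob P t x y - \sum_(y in A) mu y <= tv_dist P t mu.
Proof.
move=> mu1; rewrite /tv_dist.
apply: le_trans (le_bigmax _ _ x).
set f := fun y => step_prob P t x y - mu y.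
have f0 : \sum_y f y = 0 by rewrite sumrB step_prob_row mu1 subrr.
rewrite -sumrB -/f.
have E : \sum_(y in A) f y = - \sum_(y in ~: A) f y.
  apply/eqP; rewrite -addr_eq0; apply/eqP; rewrite -[RHS]f0 [RHS](bigID (mem A)) /=.
  by congr (_ + _); apply: eq_bigl => y; rewrite inE.
have H : 2 * \sum_(y in A) f y <= \sum_y `|f y|.
  rewrite mulr2n mulrDl !mul1r {2}E -sumrN [leRHS](bigID (mem A)) /=.
  apply: lerD; first by apply: ler_sum => y _; exact: ler_norm.
  rewrite [leLHS](_ : _ = \sum_(y | y \notin A) - f y); last by apply: eq_bigl => y; rewrite inE.
  by apply: ler_sum => y _; rewrite -normrN ler_norm.
by rewrite /f in H *; lra.
Qed.

Lemma expRN1_le : expR (-1) <= 2 / 5 :> R.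
Proof.
have e8 : expR 1 = expR 8^-1 ^+ 8 :> R.
  by rewrite -expRM_natl mulfV // pnatr_eq0.
(* Three squarings, rounded down each time, give (9/8)^8 >= 5/2. *)
have h8 : 9 / 8 <= (expR 8^-1 : R) by apply: le_trans (expR_ge1Dx _); lra.
have h4 : 253 / 200 <= (expR 8^-1 : R) ^+ 2 by nra.
have h2 : 8 / 5 <= ((expR 8^-1 : R) ^+ 2) ^+ 2 by nra.
have h1 : 5 / 2 <= (expR 1 : R) by rewrite e8 (exprM _ 4 2) (exprM _ 2 2); nra.
rewrite expRN -[leRHS]invrK lef_pV2 ?posrE ?expR_gt0 ?invr_gt0 ?divr_gt0 //.
by rewrite invf_div.
Qed.

Lemma uniform_dist_sum (x0 : S) : \sum_(x : S) @uniform_dist R S x = 1.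
Proof.
rewrite sumr_const -[_ *+ _]mulr_natl mulfV // pnatr_eq0 -lt0n.
by apply/card_gt0P; exists x0.
Qed.

(** Once mixed, the chain gives [A] mass at most 1/2 + 2/5, so from each point of [A] at least 1/10
    has escaped; summing over [A] gives a lower bound for the escaped mass. *)
Lemma bottleneck_mixing (A : {set S}) t :
  (2 * #|A| <= #|S|)%N ->
  tv_dist P t (@uniform_dist R S) <= expR (-1) ->
  #|A|%:R / 10 <= t%:R * #|exit_boundary A|%:R :> R.
Proof.
move=> A_half tvt; apply: le_trans (escape_mass_le A t).
have [->|[x0 x0A]] := set_0Vmem A.
  by rewrite cards0 mul0r sumr_ge0 // => x _; rewrite sumr_ge0 // => y _; exact: step_prob_ge0.
have S0 : 0 < #|S|%:R :> R by rewrite ltr0n; apply/card_gt0P; exists x0.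
have muA : \sum_(y in A) @uniform_dist R S y <= 2^-1.
  rewrite sumr_const -[_ *+ _]mulr_natl ler_pdivrMr //.
  by move: A_half; rewrite -(ler_nat R) natrM; lra.
have loc x : x \in A -> 10^-1 <= \sum_(y in ~: A) step_prob P t x y.
  move=> xA; have := tv_dist_ge t x A (uniform_dist_sum x0).
  have := expRN1_le; have := step_prob_row t x; rewrite (bigID (mem A)) /=.
  rewrite [X in _ + X = _ -> _](_ : _ = \sum_(y in ~: A) step_prob P t x y).
    by lra.
  by apply: eq_bigl => y; rewrite inE.
rewrite -sum1_card natr_sum mulr_suml; apply: ler_sum => x xA.
by rewrite mul1r loc.
Qed.

Lemma mixing_time_gt1 x t :
  (4 <= #|S|)%N -> 2 / 3 <= P x x ->
  tv_dist P t (@uniform_dist R S) <= expR (-1) -> (2 <= t)%N.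
Proof.
move=> S4 Pxx tvt.
have : @uniform_dist R S x <= 4^-1.
  by rewrite lef_pV2 ?posrE ?ltr0n ?(leq_trans _ S4) // ler_nat.
have := tv_dist_ge t x [set x] (uniform_dist_sum x); rewrite !big_set1.
have := expRN1_le.
case: t tvt => [|[|t]] // tvt; rewrite /= ?eqxx ?mulr1n; first by lra.
rewrite (bigD1 x) //= eqxx mul1r big1 ?addr0; first by lra.
by move=> y; rewrite eq_sym => /negbTE ->; rewrite mul0r.
Qed.
End Bottleneck.

(** * Glauber dynamics *)

Section GlauberChain.
Variables (R : realType) (V : finType) (adj : rel V).
Hypothesis adj_ex : forall v : V, exists u, adj v u.
Implicit Types chi : colouring3 adj.

Lemma num_diff1P chi1 chi2 :
  reflect (exists v, val chi2 v != val chi1 v /\ val chi2 = recolour (val chi1) v (val chi2 v))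
          (num_diff chi1 chi2 == 1)%N.
Proof.
apply: (iffP cards1P) => [[v Ev]|[v [ne E]]]; exists v.
  split.
    rewrite eq_sym; have : v \in [set v] by rewrite inE.
    by rewrite -Ev inE.
  apply/ffunP => u; rewrite ffunE; case: (eqVneq u v) => [->//|uv].
  have : u \notin [set v] by rewrite inE.
  by rewrite -Ev inE negbK => /eqP.
apply/setP => u; rewrite !inE; have [->|uv] := eqVneq u v; first by rewrite eq_sym.
by rewrite E ffunE (negbTE uv) eqxx.
Qed.

Lemma num_diffC chi1 chi2 : num_diff chi1 chi2 = num_diff chi2 chi1.
Proof. by rewrite /num_diff; apply: eq_card => v; rewrite !inE eq_sym. Qed.

Lemma glauber_sym chi1 chi2 : glauber R chi1 chi2 = glauber R chi2 chi1.
Proof.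
rewrite /glauber eq_sym; case: eqP => [->//|_].
by rewrite /glauber_offdiag num_diffC.
Qed.

Lemma glauber_row chi1 : \sum_chi2 glauber R chi1 chi2 = 1.
Proof.
rewrite (bigD1 chi1) //= {1}/glauber eqxx.
rewrite -[RHS](subrK (\sum_(chi | chi != chi1) glauber_offdiag R chi1 chi)).
congr (_ + _); apply: eq_bigr => chi; rewrite /glauber eq_sym.
by move=> /negbTE ->.
Qed.

(** [F] lists candidate results of a move, so at most [#|I|] moves leave [chi1]. The list is a
    parameter because two are needed: all pairs of a vertex and a colour for nonnegativity, one
    entry per vertex for two-coloured states. *)
Lemma glauber_diag_ge chi1 (I : finType) (F : I -> {ffun V -> 'I_3}) :
  (forall chi2, num_diff chi1 chi2 = 1%N -> exists i, val chi2 = F i) ->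
  1 - #|I|%:R / (3 * #|V|%:R) <= glauber R chi1 chi1.
Proof.
move=> HF; rewrite /glauber eqxx lerD2l lerN2.
rewrite /glauber_offdiag -big_mkcondr /= sumr_const -[_ *+ _]mulr_natl.
rewrite ler_wpM2r ?invr_ge0 ?mulr_ge0 // ler_nat.
rewrite -(card_imset _ val_inj) -cardsT; apply: leq_trans (leq_imset_card F _).
apply: subset_leq_card; apply/subsetP => _ /imsetP[chi /andP[_ /eqP /HF[i Ei]] ->].
by apply/imsetP; exists i; rewrite // Ei.
Qed.

Lemma glauber_ge0 chi1 chi2 : 0 <= glauber R chi1 chi2.
Proof.
have [<-|ne] := eqVneq chi1 chi2; last first.
  rewrite /glauber (negbTE ne) /glauber_offdiag; by case: ifP; rewrite ?invr_ge0 ?mulr_ge0.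
apply: le_trans (@glauber_diag_ge chi1 (V * 'I_3)%type
  (fun p => recolour (val chi1) p.1 p.2) _).
  rewrite card_prod card_ord subr_ge0 natrM [X in X / _]mulrC.
  have [->|n0] := eqVneq (#|V|%:R : R) 0; first by rewrite !mulr0 mul0r.
  by rewrite divff ?mulf_neq0 ?pnatr_eq0 // -(pnatr_eq0 R).
by move=> chi /eqP /num_diff1P [v [_ E]]; exists (v, val chi v).
Qed.

Lemma glauber_neq0 chi1 chi2 :
  chi1 != chi2 -> glauber R chi1 chi2 != 0 -> num_diff chi1 chi2 = 1%N.
Proof.
by rewrite /glauber /glauber_offdiag => /negbTE ->; case: ifP => [/eqP|]; rewrite ?eqxx.
Qed.

(** Every vertex has a neighbour carrying the other colour in use, so it can only move to [ord_max]:
    at most one move per vertex, each of probability 1/(3|V|). *)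
Lemma glauber_diag_two_coloured chi1 :
  (forall v, val chi1 v != ord_max) -> 2 / 3 <= glauber R chi1 chi1.
Proof.
move=> two.
apply: le_trans (@glauber_diag_ge chi1 V (fun v => recolour (val chi1) v ord_max) _).
  have [->|n0] := eqVneq (#|V|%:R : R) 0; first by rewrite mul0r; lra.
  by rewrite invfM mulrCA mulfV // mulr1; lra.
move=> chi /eqP /num_diff1P [v [ne E]]; exists v; rewrite {1}E; congr recolour.
have [u vu] := adj_ex v.
have uv : u != v.
  apply/eqP => uv; have /forallP/(_ v)/forallP/(_ v) := valP chi.
  by rewrite -{2}uv vu eqxx.
have chiu : val chi u = val chi1 u by rewrite E ffunE (negbTE uv).
have /forallP/(_ v)/forallP/(_ u) := valP chi; rewrite vu /= chiu => c1.
have /forallP/(_ v)/forallP/(_ u) := valP chi1; rewrite vu /= => c2.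
have t1 := two u; have t2 := two v.
move: (val chi v) (val chi1 v) (val chi1 u) ne c1 c2 t1 t2.
by do 3![case=> [[|[|[|?]]] ?] //=] => *; apply/val_inj.
Qed.
End GlauberChain.

(** * Sums over functions, one coordinate at a time *)

Section IteratedSum.
Variables (R : numDomainType) (V S : finType).
Implicit Types (F G : {ffun V -> S} -> R) (f : {ffun V -> S}) (l : seq V).

(* The sum of [F] over all ways of changing [f] on [l]: summing one coordinate
   at a time keeps the index type fixed in inductions on the coordinates. *)
Fixpoint isum l F f : R :=
  if l is u :: l' then \sum_s isum l' F (recolour f u s) else F f.

Lemma recolourC f u v s t : u != v ->
  recolour (recolour f u s) v t = recolour (recolour f v t) u s.
Proof.
move=> uv; apply/ffunP => x; rewrite !ffunE.
by have [->|//] := eqVneq x v; rewrite eq_sym (negbTE uv).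
Qed.

Lemma recolourK f u s t : recolour (recolour f u s) u t = recolour f u t.
Proof. by apply/ffunP => x; rewrite !ffunE; case: eqP. Qed.

Lemma le_isum l F G f : (forall g, F g <= G g) -> isum l F f <= isum l G f.
Proof.
move=> FG; elim: l f => [|u l IH] f //=.
by apply: ler_sum.
Qed.

Lemma eq_isum l F G f : F =1 G -> isum l F f = isum l G f.
Proof.
move=> FG; elim: l f => [|u l IH] f //=.
by apply: eq_bigr.
Qed.

Lemma isum_ge0 l F f : (forall g, 0 <= F g) -> 0 <= isum l F f.
Proof. by move=> F0; elim: l f => [|u l IH] f //=; apply: sumr_ge0. Qed.

Lemma isumD l F G f : isum l (fun g => F g + G g) f = isum l F f + isum l G f.
Proof.
elim: l f => [|u l IH] f //=; rewrite -big_split /=.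
by apply: eq_bigr.
Qed.

Lemma isumZ l a F f : isum l (fun g => a * F g) f = a * isum l F f.
Proof.
elim: l f => [|u l IH] f //=; rewrite mulr_sumr.
by apply: eq_bigr.
Qed.

Lemma isum_recolour l F f u s : u \notin l ->
  isum l (fun g => F (recolour g u s)) f = isum l F (recolour f u s).
Proof.
elim: l f => [|v l IH] f //=; rewrite inE negb_or => /andP[uv ul].
by apply: eq_bigr => t _; rewrite IH // recolourC // eq_sym.
Qed.

Lemma isum_sum l F f u : u \notin l ->
  isum l (fun g => \sum_s F (recolour g u s)) f = isum (u :: l) F f.
Proof.
elim: l f => [|v l IH] f //=; rewrite inE negb_or => /andP[uv ul].
under eq_bigr do rewrite IH //=.
rewrite exchange_big /=; apply: eq_bigr => t _; apply: eq_bigr => s _.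
by rewrite recolourC // eq_sym.
Qed.

Lemma isumE l F f : uniq l ->
  isum l F f = \sum_(g : {ffun V -> S} | [forall v, (v \notin l) ==> (g v == f v)]) F g.
Proof.
elim: l f => [|u l IH] f /=.
  move=> _; rewrite (big_pred1 f) // => g; apply/forallP/eqP => [E|-> //].
  by apply/ffunP => v; apply/eqP; exact: E.
case/andP=> ul ll; under eq_bigr do rewrite IH //.
rewrite [RHS](partition_big (fun g : {ffun V -> S} => g u) xpredT) //=.
apply: eq_bigr => s _; apply: eq_bigl => g; apply/forallP/andP => [E|[/forallP E /eqP gu] v].
  split; last by have := E u; rewrite ul ffunE eqxx.
  apply/forallP => v; rewrite inE negb_or; apply/implyP => /andP[vu vl].
  by have := E v; rewrite vl ffunE (negbTE vu).
rewrite ffunE; have [->|vu] := eqVneq v u; first by rewrite gu eqxx implybT.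
by have := E v; rewrite inE (negbTE vu).
Qed.

Lemma isum_all F f : isum (enum V) F f = \sum_g F g.
Proof.
rewrite isumE ?enum_uniq //; apply: eq_bigl => g; apply/forallP => v.
by rewrite mem_enum.
Qed.
Lemma isum_cat l1 l2 F f : isum (l1 ++ l2) F f = isum l1 (isum l2 F) f.
Proof. by elim: l1 f => [|u l1 IH] f //=; apply: eq_bigr. Qed.

Lemma isum_const_coord l F f u (phi : S -> R) : u \notin l ->
  isum l (fun g => phi (g u) * F g) f = phi (f u) * isum l F f.
Proof.
elim: l f => [|v l IH] f //=; rewrite inE negb_or => /andP[uv ul].
rewrite mulr_sumr; apply: eq_bigr => s _.
by rewrite IH // ffunE (negbTE uv).
Qed.

Lemma isum_prod l f (phi : S -> R) : uniq l ->
  isum l (fun g => \prod_(u <- l) phi (g u)) f = (\sum_s phi s) ^+ size l.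
Proof.
elim: l f => [|u l IH] f /=; first by rewrite big_nil.
case/andP => ul ll; rewrite exprS mulr_suml; apply: eq_bigr => s _.
rewrite -(IH (recolour f u s)) //.
under eq_isum do rewrite big_cons.
by rewrite isum_const_coord // ffunE eqxx.
Qed.
End IteratedSum.

(** * Isoperimetry in the hypercube *)

Section Isoperimetry.
Variables (R : realType) (n : nat).
Local Notation cube := (cube n).
Implicit Types (x y : cube) (i : 'I_n) (A : {set cube}).

Definition flip i x : cube := recolour x i (~~ x i).

Definition exits (J : seq 'I_n) A x : nat := count (fun i => flip i x \notin A) J.

(** The mean of [w] is Talagrand's square-root boundary functional, taken over the subcube through
    [x] with free directions [J]; [dens] is the density of [A] in that subcube. *)
Let w J A x : R := (x \in A)%:R * Num.sqrt (exits J A x)%:R.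
Let mean (J : seq 'I_n) (F : cube -> R) x : R := isum J F x / 2 ^+ size J.
Let dens J A x : R := mean J (fun y => (y \in A)%:R) x.

Lemma dens_bounds J A x : 0 <= dens J A x <= 1.
Proof.
apply/andP; split; rewrite /dens /mean.
  by rewrite divr_ge0 ?exprn_ge0 // isum_ge0.
rewrite ler_pdivrMr ?exprn_gt0 // mul1r.
apply: (le_trans (@le_isum _ _ _ _ _ (fun=> 1) _ _)); first by move=> g; rewrite lern1 leq_b1.
elim: J x => [|i J IH] x //=.
by rewrite big_bool /= exprS mulr2n mulrDl mul1r lerD.
Qed.

Lemma dens_cons i J A x :
  dens (i :: J) A x = (dens J A (recolour x i true) + dens J A (recolour x i false)) / 2.
Proof.
rewrite /dens /mean /= big_bool /= exprS.
by field; rewrite expf_neq0.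
Qed.

(* The linear form of Minkowski's inequality
   [E sqrt (f^2 + g^2) >= sqrt ((E f)^2 + (E g)^2)], with [(a, c)] in the unit disc. *)
Lemma mean_w_fibre i J A x b (a c : R) :
  i \notin J -> 0 <= a -> 0 <= c -> a ^+ 2 + c ^+ 2 <= 1 ->
  a * mean J (w J A) (recolour x i b)
    + c * (dens J A (recolour x i b) - dens J A (recolour x i (~~ b)))
  <= mean J (w (i :: J) A) (recolour x i b).
Proof.
move=> iJ a0 c0 ac1; rewrite /dens /mean -mulrBl !mulrA -mulrDl.
rewrite ler_wpM2r ?invr_ge0 ?exprn_ge0 //.
rewrite -!isum_recolour // -[- isum _ _ _]mulN1r -!isumZ -isumD -isumZ -isumD.
apply: le_isum => y; rewrite /w /exits /= /flip ffunE eqxx recolourK.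
set h := count _ J; set yb := recolour y i b; set yc := recolour y i _.
have h0 : 0 <= h%:R :> R by [].
have s0 := sqrtr_ge0 (h%:R : R); have s2 := sqr_sqrtr h0.
set s := Num.sqrt h%:R in s0 s2 *.
case: (yb \in A); case: (yc \in A) => /=;
  rewrite ?add0n ?add1n ?mulr0n ?mulr1n ?mul0r ?mul1r ?mulr0.
- rewrite -/s; nra.
(* Here the edge in direction [i] leaves [A]; the bound is Cauchy-Schwarz for [(a, c)] and
   [(s, 1)]. *)
- rewrite -natr1 -ler_sqr ?nnegrE ?sqrtr_ge0 //; last by nra.
  rewrite sqr_sqrtr ?addr_ge0 //.
  rewrite -s2; have := sqr_ge0 (c * s - a).
  have : (a ^+ 2 + c ^+ 2) * (s ^+ 2 + 1) <= s ^+ 2 + 1.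
    by rewrite ler_piMl // addr_ge0 ?sqr_ge0.
  by rewrite expr2; lra.
- lra.
- lra.
Qed.

(** Induction on the directions. Splitting along [i] into halves of densities p >= q raises the left
    side above the average over the halves by (p - q)^2 / 4; the edges in direction [i] that leave
    [A] from the denser half pay for this. *)
Lemma mean_sqrt_exits J A x : uniq J ->
  dens J A x * (1 - dens J A x) <= mean J (w J A) x.
Proof.
elim: J x => [|i J IH] x /=.
  move=> _; rewrite /dens /mean /w /exits /= expr0 !divr1 sqrtr0 mulr0.
  by case: (x \in A); rewrite /= ?subrr ?mulr0 ?mul0r.
case/andP=> iJ uJ; rewrite dens_cons.
have -> : mean (i :: J) (w (i :: J) A) x =
    (mean J (w (i :: J) A) (recolour x i true) + mean J (w (i :: J) A) (recolour x i false)) / 2.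
  rewrite /mean /= big_bool /= exprS.
  by field; rewrite expf_neq0.
(* [1 - (p - q)^2] and [p - q] are polynomial weights in the unit disc, good
   enough for the two-point inequality of [a (1 - a)]. *)
have step b : let p := dens J A (recolour x i b) in
    let q := dens J A (recolour x i (~~ b)) in q <= p ->
    ((p + q) / 2) * (1 - (p + q) / 2) <=
    (mean J (w (i :: J) A) (recolour x i b) + mean J (w (i :: J) A) (recolour x i (~~ b))) / 2.
  move=> p q qp.
  have /andP[p0 p1] : 0 <= p <= 1 by exact: dens_bounds.
  have /andP[q0 q1] : 0 <= q <= 1 by exact: dens_bounds.
  have Ip := IH (recolour x i b) uJ; have Iq := IH (recolour x i (~~ b)) uJ.
  rewrite -/p -/q in Ip Iq.
  have F1 := @mean_w_fibre i J A x b (1 - (p - q) ^+ 2) (p - q) iJ.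
  have F2 := @mean_w_fibre i J A x (~~ b) 1 0 iJ.
  rewrite -/p -/q in F1. rewrite -/q mul0r addr0 mul1r in F2.
  have {}F2 := F2 ler01 (lexx _) ltac:(lra).
  have d0 : 0 <= p - q by lra.
  have d2 : (p - q) ^+ 2 <= 1 by nra.
  have unit_disc (D : R) : 0 <= D -> D <= 1 -> (1 - D) ^+ 2 + D <= 1 by move=> *; nra.
  have {}F1 := F1 ltac:(lra) d0 (unit_disc _ (sqr_ge0 _) d2).
  have Ip' : (1 - (p - q) ^+ 2) * (p * (1 - p)) <=
     (1 - (p - q) ^+ 2) * mean J (w J A) (recolour x i b) by rewrite ler_wpM2l //; lra.
  (* Lowering the weight from 1 to 1 - (p - q)^2 costs at most half of the gain (p - q)^2; the other
     half, averaged over both halves of the cube, is the required (p - q)^2 / 4. *)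
  have g1 : (p - q) ^+ 2 * (p * (1 - p)) <= (p - q) ^+ 2 * 2^-1.
    by rewrite ler_wpM2l ?sqr_ge0 //; nra.
  by rewrite expr2 in F1 Ip' g1; lra.
have [le|/ltW le] := lerP (dens J A (recolour x i false)) (dens J A (recolour x i true)).
  exact: (step true).
by have := step false le; rewrite /= addrC [X in (X / 2)]addrC; lra.
Qed.
End Isoperimetry.

Section VertexBoundary.
Variables (R : realType) (n : nat).

(** The exit count vanishes off the inner boundary and is at most [n] on it, so each boundary vertex
    contributes at most sqrt n to the sum of the square roots. *)
Lemma vertex_boundary_ge (A : {set cube n}) :
  #|A|%:R * (1 - #|A|%:R / 2 ^+ n : R) <=
    Num.sqrt n%:R * #|[set x in A | [exists i, flip i x \notin A]]|%:R.
Proof.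
set B := [set x in A | _]; set a : R := _ / _.
have -> : #|A|%:R = 2 ^+ n * a by rewrite mulrC divfK // expf_neq0 // pnatr_eq0.
rewrite -mulrA.
pose J := enum 'I_n; have x0 : cube n := [ffun=> false].
have sJ : size J = n by rewrite size_enum_ord.
have := @mean_sqrt_exits R n J A x0 (enum_uniq _).
rewrite !isum_all sJ => H.
have cA : \sum_(y : cube n) (y \in A)%:R = #|A|%:R :> R.
  by rewrite -natr_sum -big_mkcond sum1_card.
rewrite cA -/a in H.
rewrite -ler_pdivlMl ?exprn_gt0 // [leRHS]mulrC; apply: le_trans H _.
rewrite ler_wpM2r ?invr_ge0 ?exprn_ge0 //.
rewrite -sum1_card natr_sum mulr_sumr [leRHS]big_mkcond /=.
apply: ler_sum => x _; rewrite inE mulr1.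
case: (x \in A) => /=; last by rewrite mul0r.
rewrite mul1r; case: existsP => [[i xi]|xA].
  by rewrite ler_wsqrtr // ler_nat /exits (leq_trans (count_size _ _)) // sJ.
rewrite /exits (_ : count _ _ = 0)%N ?sqrtr0 //.
apply/eqP; rewrite -leqn0 leqNgt -has_count; apply/hasP => -[i _ xi].
by apply: xA; exists i.
Qed.
End VertexBoundary.

Definition nb (V : finType) (adj : rel V) (v : V) : {set V} := [set u | adj v u].

Definition nbs (V : finType) (adj : rel V) (A : {set V}) : {set V} :=
  [set u | [exists w in A, adj w u]].

(** * Parity classes of the hypercube and their expansion *)

Section Cube.
Variable d : nat.
Implicit Types (x y : cube d) (i : 'I_d).

Definition parity x : bool := odd #|[set i | x i]|.

Lemma flipE i x j : flip i x j = (j == i) (+) x j.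
Proof. by rewrite ffunE; case: eqP => [->|//]. Qed.

Lemma flipK i : involutive (flip i).
Proof. by move=> x; apply/ffunP => j; rewrite !flipE addbA addbb. Qed.

Lemma mem_flip_imset i (A : {set cube d}) x :
  (x \in [set flip i y | y in A]) = (flip i x \in A).
Proof. by rewrite (can_imset_pre _ (flipK i)) inE. Qed.

Lemma flipC i j x : flip i (flip j x) = flip j (flip i x).
Proof. by apply/ffunP => k; rewrite !flipE addbCA. Qed.

Lemma cube_adjP x y : reflect (exists i, y = flip i x) (cube_adj x y).
Proof.
apply: (iffP cards1P) => [[i Ei]|[i ->]]; exists i.
  apply/ffunP => j; rewrite flipE; have : (j \in [set i]) = (x j != y j) by rewrite -Ei inE.
  by rewrite inE => ->; case: (x j); case: (y j).
by apply/setP => j; rewrite !inE flipE; case: (j == i); case: (x j).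
Qed.

Lemma cube_adjC x y : cube_adj x y = cube_adj y x.
Proof. by rewrite /cube_adj; congr (_ == _); apply: eq_card => i; rewrite !inE eq_sym. Qed.

Lemma parity_flip i x : parity (flip i x) = ~~ parity x.
Proof.
rewrite /parity (cardsD1 i) [in RHS](cardsD1 i) !oddD !inE flipE eqxx /=.
rewrite (_ : [set j | flip i x j] :\ i = [set j | x j] :\ i); last first.
  by apply/setP => j; rewrite !inE flipE; case: (j == i).
by case: (x i) => /=; rewrite ?negbK.
Qed.

Lemma cube_adj_parity x y : cube_adj x y -> parity y = ~~ parity x.
Proof. by move=> /cube_adjP[i ->]; exact: parity_flip. Qed.

Lemma card_nb_cube x : #|nb (@cube_adj d) x| = d.
Proof.
rewrite (_ : nb _ _ = [set flip i x | i in 'I_d]).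
  rewrite card_imset ?card_ord // => i j /ffunP/(_ i).
  by rewrite !flipE eqxx; case: eqP => // _; case: (x i).
apply/setP => y; rewrite inE; apply/cube_adjP/imsetP => [[i ->]|[i _ ->]]; by exists i.
Qed.

Lemma card_cube : #|cube d| = (2 ^ d)%N.
Proof. by rewrite card_ffun card_bool card_ord. Qed.

Lemma card_parity b : (0 < d)%N -> #|[set x | parity x == b]| = (2 ^ d.-1)%N.
Proof.
move=> d0; pose i := Ordinal d0.
have E : #|[set x | parity x == b]| = #|[set x | parity x == ~~ b]|.
  rewrite -(card_imset _ (can_inj (flipK i))); apply: eq_card => x.
  rewrite mem_flip_imset !inE parity_flip.
  by case: (parity x); case: b.
have : (#|[set x | parity x == b]| + #|[set x | parity x == ~~ b]| = 2 ^ d)%N.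
  rewrite -card_cube -(cardsC [set x | parity x == b]); congr (_ + _)%N.
  by apply: eq_card => x; rewrite !inE; case: (parity x); case: (b).
have -> : (2 ^ d = 2 * 2 ^ d.-1)%N by rewrite -expnS prednK.
by rewrite -E addnn -mul2n => /eqP; rewrite eqn_mul2l /= => /eqP.
Qed.

Lemma nbs_parity_ge (R : realType) (A : {set cube d}) :
  (0 < d)%N -> A \subset [set x | parity x] ->
  #|A|%:R * (1 - #|A|%:R / 2 ^+ d.-1 : R) <=
    Num.sqrt d%:R * (#|nbs (@cube_adj d) A|%:R - #|A|%:R).
Proof.
(* Apply the vertex bound to the complement of [A] together with its translate
   by one coordinate direction, which is a perfect matching between the parities. *)
move=> d0 Aodd; set N : R := 2 ^+ d.-1; set a := _ / N; pose i := Ordinal d0.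
have Ao x : x \in A -> parity x by move/(subsetP Aodd); rewrite inE.
pose fA := [set flip i x | x in A].
have in_fA x : (x \in fA) = (flip i x \in A) by rewrite mem_flip_imset.
have cfA : #|fA| = #|A| by rewrite card_imset //; exact: (can_inj (flipK i)).
have fAn : fA \subset nbs (@cube_adj d) A.
  apply/subsetP => x; rewrite in_fA inE => xA; apply/existsP; exists (flip i x).
  by rewrite xA /=; apply/cube_adjP; exists i; rewrite flipK.
pose D := nbs (@cube_adj d) A :\: fA.
have cD : (#|nbs (@cube_adj d) A| = #|A| + #|D|)%N.
  by rewrite -(cardsID fA) (setIidPr fAn) cfA.
pose B := ~: (A :|: fA).
have cB : (#|B| + 2 * #|A| = 2 ^ d)%N.
  have : #|A :|: fA| = (2 * #|A|)%N.
    rewrite cardsU cfA (_ : A :&: fA = set0) ?cards0 ?subn0 ?mul2n ?addnn //.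
    apply/setP => x; rewrite !inE in_fA; apply/andP => -[/Ao xo /Ao].
    by rewrite parity_flip xo.
  by move=> <-; rewrite -card_cube -(cardsC (A :|: fA)) addnC.
have := @vertex_boundary_ge R d B.
set b := #|B|%:R / _.
have N2 : (2 : R) ^+ d = 2 * N by rewrite -exprS prednK.
have N0 : 0 < N by rewrite exprn_gt0.
have Na : #|A|%:R = N * a by rewrite mulrC divfK // lt0r_neq0.
have Nb : #|B|%:R = 2 * N * b by rewrite -N2 mulrC divfK // lt0r_neq0 // exprn_gt0.
rewrite {}Nb (_ : b = 1 - a); last first.
  rewrite /b /a N2; move/(congr1 (fun k => k%:R : R)): cB.
  rewrite natrD natrM natrX N2 => cB; have -> : #|B|%:R = 2 * N - 2 * #|A|%:R by rewrite -cB addrK.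
  by field; rewrite lt0r_neq0.
set X := [set x in B | _].
(* Let [x] in [B] have the neighbour [flip j x] outside [B]. If that neighbour is in [A], then [x]
   is in [D]; if it is in [fA], then [flip i x] is in [D]. *)
have cX : (#|X| <= 2 * #|D|)%N.
  have XD : X \subset D :|: [set flip i x | x in D].
    apply/subsetP => x; rewrite !inE !negb_or mem_flip_imset.
    rewrite !inE !in_fA flipK => /andP[/andP[xA xfA] /existsP[j]].
    rewrite inE negbK inE in_fA => /orP[jA|jA]; apply/orP; [left|right].
      rewrite xfA /=; apply/existsP; exists (flip j x); rewrite jA.
      by apply/cube_adjP; exists j; rewrite flipK.
    rewrite xA /=; apply/existsP; exists (flip i (flip j x)); rewrite jA.
    by apply/cube_adjP; exists j; rewrite flipC flipK.
  apply: (leq_trans (subset_leq_card XD)); apply: (leq_trans (leq_card_setU _ _)).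
  by rewrite mul2n -addnn leq_add2l leq_imset_card.
rewrite subKr => H; rewrite cD natrD addrAC subrr add0r Na.
have : Num.sqrt d%:R * #|X|%:R <= Num.sqrt d%:R * (2 * #|D|%:R) :> R.
  by rewrite ler_wpM2l ?sqrtr_ge0 // -natrM ler_nat.
by lra.
Qed.
End Cube.

(** * Finner's inequality *)

Section Hoelder.
Variable R : realType.

Lemma powR_prod (I : Type) (r : seq I) (P : pred I) (F : I -> R) (a : R) :
  (forall i, P i -> 0 <= F i) ->
  (\prod_(i <- r | P i) F i) `^ a = \prod_(i <- r | P i) F i `^ a.
Proof.
move=> F0; suff [] : (\prod_(i <- r | P i) F i) `^ a = \prod_(i <- r | P i) F i `^ a
    /\ 0 <= \prod_(i <- r | P i) F i by [].
elim/big_ind2: _ => [|x1 x2 y1 y2 [<- x0] [<- y0]|i Pi]; first by rewrite powR1.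
  by rewrite powRM // mulr_ge0.
by split => //; apply: F0.
Qed.

(** Hoelder's inequality with [#|K|] equal exponents: scale each [a i] to total mass 1 and apply the
    AM-GM inequality at each [s]. If some total is 0, the left side vanishes. *)
Lemma hoelder_sum (I S : finType) (K : {set I}) (a : I -> S -> R) :
  (0 < #|K|)%N -> (forall i s, 0 <= a i s) ->
  \sum_s \prod_(i in K) a i s `^ #|K|%:R^-1 <=
    \prod_(i in K) (\sum_s a i s) `^ #|K|%:R^-1.
Proof.
move=> K0 a0; set p := _^-1.
have d0 : 0 < #|K|%:R :> R by rewrite ltr0n.
have p0 : 0 < p by rewrite invr_gt0.
have M0 i : 0 <= \sum_s a i s by exact: sumr_ge0.
case: (pickP [pred i in K | \sum_s a i s == 0]) => [i /= /andP[iK /eqP Mi]|Mpos].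
  rewrite big1 => [|s _]; first by apply: prodr_ge0 => j _; exact: powR_ge0.
  have /eqP : a i s = 0 by apply: (psumr_eq0P _ Mi).
  by move/eqP => ais; rewrite (bigD1 i) //= ais powR0 ?mul0r // gt_eqF.
have Mi i : i \in K -> 0 < \sum_s a i s.
  by move=> iK; rewrite lt0r M0 andbT; have := Mpos i; rewrite /= iK => /negbT.
pose b i s := a i s / \sum_s a i s.
have b0 i s : 0 <= b i s by rewrite divr_ge0.
have amgm s : \prod_(i in K) b i s `^ p <= (\sum_(i in K) b i s) / #|K|%:R.
  rewrite -powR_prod //; set m := leRHS.
  have m0 : 0 <= m by rewrite divr_ge0 ?sumr_ge0.
  have -> : m = (m ^+ #|K|) `^ p by rewrite -powR_mulrn // -powRrM mulfV ?powRr1 // lt0r_neq0.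
  apply: ge0_ler_powR; rewrite ?nnegrE ?prodr_ge0 ?exprn_ge0 //; first exact: ltW.
  by case: (@leif_AGM R I (mem K) (b^~ s) (fun i _ => b0 i s)).
rewrite (_ : \sum_s _ = (\prod_(i in K) (\sum_s a i s) `^ p) * \sum_s \prod_(i in K) b i s `^ p).
  rewrite ler_piMr ?prodr_ge0 // => [i _|]; first exact: powR_ge0.
  apply: (@le_trans _ _ (\sum_s (\sum_(i in K) b i s) / #|K|%:R)).
    by apply: ler_sum => s _.
  rewrite -mulr_suml exchange_big /= ler_pdivrMr // mul1r -sum1_card natr_sum.
  by apply: ler_sum => i iK; rewrite -mulr_suml mulfV ?gt_eqF ?Mi.
rewrite mulr_sumr; apply: eq_bigr => s _; rewrite -big_split /=; apply: eq_bigr => i iK.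
by rewrite -powRM // /b mulrC divfK // gt_eqF ?Mi.
Qed.

(** Induction on the coordinates: summing out [u] affects only the [d] factors whose support
    contains [u], and Hoelder's inequality moves that sum inside them, replacing [G] by [G']. *)
Lemma finner (V S I : finType) (d : nat) (supp : I -> {set V})
    (G : I -> {ffun V -> S} -> R) (l : seq V) f :
  (0 < d)%N -> uniq l ->
  (forall u, u \in l -> #|[set i | u \in supp i]| = d) ->
  (forall i g, 0 <= G i g) ->
  (forall i u g s, u \notin supp i -> G i (recolour g u s) = G i g) ->
  isum l (fun g => \prod_i G i g `^ d%:R^-1) f <=
    \prod_i (isum [seq u <- l | u \in supp i] (G i) f) `^ d%:R^-1.
Proof.
move=> d0; elim: l G => [|u l IH] G //= /andP[ul ll] deg G0 Gsupp.
pose G' i g := if u \in supp i then \sum_s G i (recolour g u s) else G i g.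
have G'0 i g : 0 <= G' i g by rewrite /G'; case: ifP => // _; exact: sumr_ge0.
have -> : \sum_s isum l (fun g => \prod_i G i g `^ d%:R^-1) (recolour f u s) =
    isum (u :: l) (fun g => \prod_i G i g `^ d%:R^-1) f by [].
rewrite -isum_sum //.
apply: (@le_trans _ _ (isum l (fun g => \prod_i G' i g `^ d%:R^-1) f)).
  apply: le_isum => g; have du := deg u (mem_head _ _).
  rewrite [leRHS](bigID (mem [set i | u \in supp i])) /=.
  rewrite (_ : \sum_s _ = (\sum_s \prod_(i in [set i | u \in supp i])
      G i (recolour g u s) `^ d%:R^-1)
      * \prod_(i | i \notin [set i | u \in supp i]) G' i g `^ d%:R^-1).
    rewrite ler_wpM2r ?prodr_ge0 // => [i _|]; first exact: powR_ge0.
    have := @hoelder_sum I S [set i | u \in supp i] (fun i s => G i (recolour g u s)).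
    rewrite du => /(_ d0 (fun i s => G0 i _)) /le_trans; apply.
    by rewrite le_eqVlt; apply/orP; left; apply/eqP; apply: eq_bigr => i; rewrite inE /G' => ->.
  rewrite mulr_suml; apply: eq_bigr => s _.
  rewrite (bigID (mem [set i | u \in supp i])) /=; congr (_ * _).
  by apply: eq_bigr => i; rewrite inE /G' => iu; rewrite Gsupp // (negbTE iu).
apply: le_trans (IH G' ll _ G'0 _) _.
- by move=> v vl; rewrite deg // inE vl orbT.
- move=> i v g s vi; rewrite /G'; case: ifP => iu; last by rewrite Gsupp.
  have vu : v != u by apply: contraNneq vi => ->.
  by apply: eq_bigr => t _; rewrite recolourC // Gsupp.
rewrite le_eqVlt; apply/orP; left; apply/eqP; apply: eq_bigr => i _; congr (_ `^ _).
rewrite /G'; case: ifP => iu //=.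
by rewrite isum_sum // mem_filter negb_and ul orbT.
Qed.
End Hoelder.

(** * Colourings with many nearly monochrome vertices *)

Section NearlyMono.
Variables (R : realType) (V : finType) (adj : rel V) (side : pred V) (d : nat).
Hypothesis d_gt0 : (0 < d)%N.
Hypothesis adjC : symmetric adj.
Hypothesis adj_side : forall u v, adj u v -> side v = ~~ side u.
Hypothesis regular : forall v, #|nb adj v| = d.
Implicit Types (f g : {ffun V -> 'I_3}) (u v w : V) (i c : 'I_3).

Definition exc f w i : nat := #|[set u in nb adj w | f u != i]|.

Definition monochrome f : {set V} := [set w | side w && [exists i, exc f w i == 0%N]].

Definition nearly_mono f : {set V} :=
  [set w | [&& side w, w \notin monochrome f & [exists i, (8 * exc f w i <= d)%N]]].

Let free w f c : bool := [forall u in nb adj w, f u != c].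
Let lam w f : R := if w \in nearly_mono f then 4 / 3 else 1.

Lemma eq_nearly_mono w f g : {in nb adj w, f =1 g} ->
  ((w \in monochrome f) = (w \in monochrome g)) * ((w \in nearly_mono f) = (w \in nearly_mono g)).
Proof.
move=> fg; have E i : exc f w i = exc g w i.
  by apply: eq_card => u; rewrite !inE; case: (boolP (adj w u)) => //= wu; rewrite fg ?inE.
have mE : (w \in monochrome f) = (w \in monochrome g).
  by rewrite !inE; under eq_existsb do rewrite E.
by split; rewrite // [LHS]inE [RHS]inE mE; under eq_existsb do rewrite E.
Qed.

(* The three sums account for the monochrome, the remaining, and the nearly
   monochrome neighbourhoods; in the last, [(6/5)^d (1/4)^k >= 1] when [8 k <= d],
   and [8/5 = (4/3) (6/5)], so that summing out each neighbour costs [(8/5) (5/4) = 2]. *)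
Lemma local_weight_le w g : side w ->
  ((\sum_c (free w g c)%:R) * lam w g) ^+ d <=
  \sum_i 2 ^+ d * \prod_(u in nb adj w) (g u == i)%:R
  + \sum_i \prod_(u in nb adj w) (g u != i)%:R
  + \sum_i \sum_k (8 / 5) ^+ d *
      \prod_(u in nb adj w) (if g u == k then 0 else if g u == i then 1 else 4^-1) :> R.
Proof.
move=> ws.
have prod_ge0 (phi : 'I_3 -> R) : (forall s, 0 <= phi s) ->
    0 <= \prod_(u in nb adj w) phi (g u) by move=> ?; apply: prodr_ge0.
have T1 i : 0 <= 2 ^+ d * \prod_(u in nb adj w) (g u == i)%:R :> R.
  by rewrite mulr_ge0 ?exprn_ge0 // prodr_ge0.
have T2 i : 0 <= \prod_(u in nb adj w) (g u != i)%:R :> R by rewrite prodr_ge0.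
have T3 i k : 0 <= (8 / 5) ^+ d *
    \prod_(u in nb adj w) (if g u == k then 0 else if g u == i then 1 else 4^-1) :> R.
  rewrite mulr_ge0 ?exprn_ge0 ?prodr_ge0 // => u _.
  by case: ifP => // _; case: ifP.
have [u0 u0w] : exists u0, u0 \in nb adj w.
  by apply/set0Pn; rewrite -card_gt0 regular.
have [/existsP[i /eqP exc0]|nomono] := boolP [exists i, exc g w i == 0%N].
  have allx u : u \in nb adj w -> g u = i.
    move=> uw; apply/eqP; move/eqP: exc0; rewrite cards_eq0 => /eqP/setP/(_ u).
    by rewrite !inE; rewrite inE in uw; rewrite uw /= => /negbFE.
  have -> : lam w g = 1.
    rewrite /lam ifF // inE inE ws /=; apply/negP => /andP[/existsP[]]; exists i.
    by rewrite exc0.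
  rewrite mulr1 -addrA -[leLHS]addr0 lerD ?addr_ge0 ?sumr_ge0 //; last first.
    by move=> k _; rewrite sumr_ge0.
  rewrite [leRHS](bigD1 i) //= -[leLHS]addr0 lerD ?sumr_ge0 //.
  rewrite [X in _ <= _ * X]big1 ?mulr1 => [|u /allx ->]; last by rewrite eqxx.
  rewrite lerXn2r ?nnegrE ?sumr_ge0 //.
  rewrite (bigD1 i) //= (_ : free w g i = false) ?add0r; last first.
    by apply/negbTE/forall_inPn; exists u0; rewrite // allx ?eqxx.
  apply: (@le_trans _ _ (\sum_(c | c != i) 1)).
    by apply: ler_sum => c _; rewrite lern1 leq_b1.
  by rewrite sumr_const cardC1 card_ord.
(* Two free colours would leave a single colour for the neighbourhood, making it monochrome. *)
have notfree2 k c : free w g k -> free w g c -> k = c.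
  move=> fk fc; apply/eqP/negPn/negP => kc; case/negP: nomono.
  have gu0k := forall_inP fk _ u0w; have gu0c := forall_inP fc _ u0w.
  apply/existsP; exists (g u0); rewrite cards_eq0; apply/eqP/setP => u; rewrite !inE.
  apply/negbTE/negP => /andP[uw gu].
  have guk := forall_inP fk u; have guc := forall_inP fc u; rewrite !inE uw in guk guc.
  move: (g u) (g u0) kc gu0k gu0c gu (guk isT) (guc isT).
  move: k c {fk fc guk guc} => [[|[|[|?]]] ?] [[|[|[|?]]] ?] //;
  by move=> [[|[|[|?]]] ?] [[|[|[|?]]] ?].
have [k fk|nofree] := pickP (free w g); last first.
  rewrite big1 => [|c _]; last by rewrite nofree.
  rewrite mul0r expr0n gtn_eqF //=.
  by rewrite !addr_ge0 ?sumr_ge0 // => i _; rewrite sumr_ge0.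
rewrite (bigD1 k) //= fk big1 ?addr0 ?mul1r; last first.
  move=> c ck; case fc : (free w g c) => //.
  by rewrite (notfree2 _ _ fk fc) eqxx in ck.
have [wn|wn] := boolP (w \in nearly_mono g); rewrite /lam ?wn ?(negbTE wn); last first.
  rewrite expr1n -[leLHS]addr0 lerD ?sumr_ge0 // => [|i _]; last by rewrite sumr_ge0.
  rewrite -[leLHS]add0r lerD ?sumr_ge0 //.
  rewrite [leRHS](bigD1 k) //= -[leLHS]addr0 lerD ?sumr_ge0 //.
  by rewrite big1 // => u uw; rewrite (forall_inP fk).
rewrite -[leLHS]add0r lerD ?addr_ge0 ?sumr_ge0 //.
move: (wn); rewrite inE => /and3P[_ _ /existsP[i exci]].
rewrite [leRHS](bigD1 i) //= -[leLHS]addr0 lerD ?sumr_ge0 // => [|j _]; last by rewrite sumr_ge0.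
rewrite [leRHS](bigD1 k) //= -[leLHS]addr0 lerD ?sumr_ge0 //.
have -> : \prod_(u in nb adj w) (if g u == k then 0 else if g u == i then 1 else 4^-1)
    = 4^-1 ^+ exc g w i :> R.
  rewrite (bigID (fun u => g u == i)) /= big1 ?mul1r.
    rewrite /exc -prodr_const; apply: eq_big => [u|u /andP[uw /negbTE ->]]; first by rewrite !inE.
    by rewrite (negbTE (forall_inP fk _ uw)).
  by move=> u /andP[uw ->]; rewrite (negbTE (forall_inP fk _ uw)).
have -> : 8 / 5 = (4 / 3) * (6 / 5) :> R by field.
rewrite [(4 / 3 * _) ^+ d]exprMn -mulrA ler_peMr ?exprn_ge0 ?divr_ge0 //.
apply: (@le_trans _ _ ((6 / 5) ^+ (8 * exc g w i) * 4^-1 ^+ exc g w i)).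
  rewrite exprM -exprMn exprn_ege1 //.
  have h2 : 36 / 25 <= (6 / 5) ^+ 2 :> R by lra.
  have h4 : 2 <= ((6 / 5) ^+ 2) ^+ 2 :> R by nra.
  by rewrite (exprM _ 4 2) (exprM _ 2 2); nra.
by rewrite ler_wpM2r ?exprn_ge0 // ler_weXn2l //; lra.
Qed.

(** The local bound consists of 3 + 3 + 9 product functions, each summing to at most 2^d; 15 is
    rounded up to 2^4. *)
Lemma local_sum_le w l f : side w -> uniq l -> l =i nb adj w ->
  isum l (fun g => ((\sum_c (free w g c)%:R) * lam w g) ^+ d) f <= 2 ^+ (d + 4).
Proof.
move=> ws ul ln.
have sl : size l = d by rewrite -(regular w) (eq_card (B := mem l)) ?(card_uniqP ul).
have prodE (phi : 'I_3 -> R) g : \prod_(u in nb adj w) phi (g u) = \prod_(u <- l) phi (g u).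
  rewrite -big_enum /=; apply: perm_big; apply: uniq_perm; rewrite ?enum_uniq // => u.
  by rewrite mem_enum ln.
have isP (phi : 'I_3 -> R) : isum l (fun g => \prod_(u in nb adj w) phi (g u)) f
    = (\sum_s phi s) ^+ d.
  under eq_isum do rewrite prodE.
  by rewrite isum_prod // sl.
apply: le_trans (le_isum _ _ (fun g => local_weight_le g ws)) _.
have isum_sumF (F : 'I_3 -> {ffun V -> 'I_3} -> R) : 
    isum l (fun g => \sum_i F i g) f = \sum_i isum l (F i) f.
  under eq_isum do rewrite !big_ord_recl big_ord0 addr0.
  by rewrite !isumD !big_ord_recl big_ord0 addr0.
rewrite !isumD !isum_sumF.
apply: (@le_trans _ _ (\sum_(i < 3) 2 ^+ d + \sum_(i < 3) 2 ^+ d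
    + \sum_(i < 3) \sum_(k < 3) 2 ^+ d)); last first.
  have -> : 2 ^+ (d + 4) = 16 * 2 ^+ d :> R by rewrite exprD mulrC; congr (_ * _); ring.
  rewrite !sumr_const !card_ord.
  by have : 0 <= 2 ^+ d :> R by []; lra.
apply: lerD; [apply: lerD|]; apply: ler_sum => i _.
- rewrite isumZ (isP (fun s => (s == i)%:R)) (_ : \sum_s _ = 1) ?expr1n ?mulr1 //.
  by rewrite (bigD1 i) //= eqxx big1 ?addr0 // => j /negbTE ->.
- rewrite (isP (fun s => (s != i)%:R)) (_ : \sum_s _ = 2) //.
  by rewrite !big_ord_recl big_ord0; case: i => [[|[|[|?]]] ?] //=; lra.
rewrite isum_sumF; apply: ler_sum => k _.
rewrite isumZ (isP (fun s => if s == k then 0 else if s == i then 1 else 4^-1)).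
rewrite -exprMn lerXn2r ?nnegrE ?mulr_ge0 ?sumr_ge0 //.
  by move=> s _; case: ifP => // _; case: ifP.
rewrite !big_ord_recl big_ord0.
by case: i k => [[|[|[|?]]] ?] // [[|[|[|?]]] ?] //=; lra.
Qed.
Lemma free_recolour w f u c s : ~~ adj w u -> free w (recolour f u s) c = free w f c.
Proof.
move=> wu; apply: eq_forallb_in => v; rewrite inE => wv; rewrite ffunE.
by have [vu|//] := eqVneq v u; rewrite vu (negbTE wu) in wv.
Qed.

Lemma lam_recolour w f u s : ~~ adj w u -> lam w (recolour f u s) = lam w f.
Proof.
move=> wu; rewrite /lam (eq_nearly_mono (f := recolour f u s) (g := f)) // => v.
rewrite inE => wv; rewrite ffunE.
by have [vu|//] := eqVneq v u; rewrite vu (negbTE wu) in wv.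
Qed.

Lemma sideN w u : adj w u -> (w == u) = false.
Proof. by move=> /adj_side wu; apply/eqP => E; move: wu; rewrite E; case: (side u). Qed.

(** Weight each proper colouring by 4/3 per nearly monochrome vertex. With the other class fixed,
    summing over the colours of a vertex [w] on [side] yields its number of free colours times
    [lam w]; Finner's inequality then reduces the sum over the other class to single
    neighbourhoods. *)
Lemma nearly_mono_count m :
  #|[set f | proper_colouring adj f & (m <= #|nearly_mono f|)%N]|%:R * (4 / 3) ^+ m
    <= ((2 ^+ (d + 4)) `^ d%:R^-1) ^+ #|[set w | side w]| :> R.
Proof.
pose f0 : {ffun V -> 'I_3} := [ffun=> ord0].
pose g w f : R := if side w then (free w f (f w))%:R * lam w f else 1.
pose b w f : R := if side w then (\sum_c (free w f c)%:R) * lam w f else 1.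
have lam_gt0 w f : 0 < lam w f by rewrite /lam; case: ifP => // _; rewrite divr_gt0.
have g0 w f : 0 <= g w f by rewrite /g; case: ifP => // _; rewrite mulr_ge0 // ltW.
have b0 w f : 0 <= b w f by rewrite /b; case: ifP => // _; rewrite mulr_ge0 ?sumr_ge0 // ltW.
apply: (@le_trans _ _ (\sum_f \prod_w g w f)).
  rewrite -sum1_card natr_sum mulr_suml [leLHS]big_mkcond /=; apply: ler_sum => f _.
  rewrite inE; case: andP => [[pf mf]|_]; last exact: prodr_ge0.
  rewrite mul1r; apply: (@le_trans _ _ ((4 / 3) ^+ #|nearly_mono f|)).
    by rewrite ler_weXn2l //; lra.
  rewrite -prodr_const [leLHS]big_mkcond; apply: ler_prod => w _.
  rewrite /g /lam; case: (boolP (w \in nearly_mono f)) => wn; last first.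
    rewrite ler01 /=; case: ifP => // _; rewrite mulr1.
    rewrite (_ : free w f (f w)) //; apply/forall_inP => u; rewrite inE => wu.
    by have /forallP/(_ w)/forallP/(_ u) := pf; rewrite wu eq_sym.
  rewrite divr_ge0 //=; move: (wn); rewrite inE => /andP[-> _].
  rewrite (_ : free w f (f w)) ?mul1r //; apply/forall_inP => u; rewrite inE => wu.
  by have /forallP/(_ w)/forallP/(_ u) := pf; rewrite wu eq_sym.
pose lO := enum [set w | side w]; pose lE := enum [set w | ~~ side w].
have inO v : (v \in lO) = side v by rewrite mem_enum inE.
have inE' v : (v \in lE) = ~~ side v by rewrite mem_enum inE.
have -> : \sum_f \prod_w g w f = isum (lE ++ lO) (fun f => \prod_w g w f) f0.
  rewrite isumE.
    by apply: eq_bigl => f; apply/esym/forallP => v; rewrite mem_cat inO inE' orNb.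
  rewrite cat_uniq !enum_uniq andbT /=; apply/hasPn => v /=; rewrite inO inE'.
  by move=> ->.
rewrite isum_cat.
apply: (@le_trans _ _ (isum lE (fun f => \prod_w b w f) f0)).
  apply: le_isum => f.
  (* With [d = 1] Finner's inequality is plain factorisation: among the vertices being summed, the
     support of the factor of [w] contains only [w]. *)
  pose supp w := if side w then w |: nb adj w else set0.
  have := @finner R V _ V 1 supp g lO f isT (enum_uniq _).
  rewrite invr1.
  under eq_isum do under eq_bigr do rewrite powRr1 //.
  move=> fin; apply: le_trans (fin _ g0 _) _.
  - move=> u; rewrite inO => us; apply/eqP/cards1P; exists u; apply/setP => w.
    rewrite !inE /supp; case: ifP => ws; rewrite !inE.
      rewrite eq_sym; case: (boolP (adj w u)) => [/adj_side|]; last by rewrite orbF.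
      by rewrite us ws.
    by apply/esym/negbTE; apply: contraFneq ws => ->.
  - move=> w u h s; rewrite /supp /g; case: ifP => // ws.
    rewrite !inE negb_or => /andP[uw wu].
    by rewrite free_recolour // lam_recolour // ffunE eq_sym (negbTE uw).
  apply: ler_prod => w _; rewrite powR_ge0 powRr1 ?isum_ge0 //=.
  rewrite /supp /b; case: ifP => ws; last first.
    rewrite (eq_filter (a2 := pred0)) ?filter_pred0 /= /g ?ws // => u.
    by rewrite inE.
  rewrite (eq_in_filter (a2 := pred1 w)).
    rewrite filter_pred1_uniq ?enum_uniq ?inO //= mulr_suml le_eqVlt; apply/orP; left.
    apply/eqP; apply: eq_bigr => c _; have ww : ~~ adj w w by apply/negP => /sideN; rewrite eqxx.
    by rewrite /g ws free_recolour // lam_recolour // ffunE eqxx.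
  move=> u; rewrite inO !inE => us; case: (boolP (adj w u)) => [/adj_side|]; last by rewrite orbF.
  by rewrite us ws.
(* Each remaining vertex lies in exactly [d] of these neighbourhoods, so the factors are written as
   [d]-th roots of their [d]-th powers. *)
pose supp w := if side w then nb adj w else set0.
have -> : isum lE (fun f => \prod_w b w f) f0 =
    isum lE (fun f => \prod_w (b w f ^+ d) `^ d%:R^-1) f0.
  apply: eq_isum => f; apply: eq_bigr => w _.
  by rewrite -powR_mulrn // -powRrM mulfV ?powRr1 // pnatr_eq0 -lt0n.
apply: le_trans (@finner R V _ V d supp (fun w f => b w f ^+ d) lE f0 d_gt0 (enum_uniq _) _ _ _) _.
- move=> u; rewrite inE' => us; rewrite -(regular u); apply: eq_card => w.
  rewrite !inE /supp; case: ifP => ws; rewrite !inE; first by rewrite adjC.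
  by case: (boolP (adj u w)) => // /adj_side; rewrite ws (negbTE us).
- by move=> w f; rewrite exprn_ge0.
- move=> w u f s; rewrite /supp /b; case: ifP => // ws; rewrite inE => wu.
  rewrite lam_recolour //; congr ((_ * _) ^+ _); apply: eq_bigr => c _.
  by rewrite free_recolour.
rewrite (bigID (mem [set w | side w])) /= [X in _ * X]big1 ?mulr1; last first.
  move=> w; rewrite inE /supp => ws; rewrite (negbTE ws) (eq_filter (a2 := pred0)).
    by rewrite filter_pred0 /= /b (negbTE ws) expr1n powR1.
  by move=> u; rewrite inE.
rewrite -prodr_const; apply: ler_prod => w; rewrite inE => ws; rewrite powR_ge0 /=.
apply: ge0_ler_powR; rewrite ?nnegrE ?invr_ge0 ?exprn_ge0 ?isum_ge0 //.
  by move=> h; rewrite exprn_ge0.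
rewrite /supp /b ws; apply: local_sum_le => //; first by rewrite filter_uniq ?enum_uniq.
move=> u; rewrite mem_filter inE'; case: (boolP (u \in nb adj w)) => //.
by rewrite inE => /adj_side ->; rewrite ws.
Qed.
End NearlyMono.

(** * Colourings with few nearly monochrome vertices *)

Section Cover.
Variables (R : realType) (V : finType) (adj : rel V).
Hypothesis adjC : symmetric adj.

Lemma edge_count (A B : {set V}) :
  (\sum_(u in A) #|nb adj u :&: B| = \sum_(w in B) #|nb adj w :&: A|)%N.
Proof.
have E (C D : {set V}) : (\sum_(u in C) #|nb adj u :&: D| = \sum_(u in C) \sum_(w in D) adj u w)%N.
  apply: eq_bigr => u _; rewrite -sum1_card [LHS]big_mkcond [RHS]big_mkcond /=.
  by apply: eq_bigr => w _; rewrite !inE; case: (adj u w); case: (w \in D).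
rewrite !E exchange_big /=; apply: eq_bigr => w _; apply: eq_bigr => u _.
by rewrite adjC.
Qed.

(** Greedy choice: by double counting, some vertex of [P] is adjacent to at least a fraction d/(8N)
    of the vertices of [W] not yet covered; adding it to [T] shrinks the uncovered set by the factor
    1 - d/(8N). *)
Lemma greedy_cover (P W : {set V}) (d N t : nat) :
  (0 < d)%N -> (#|P| <= N)%N ->
  (forall w, w \in W -> (d <= 8 * #|nb adj w :&: P|)%N) ->
  exists T : {set V}, [/\ T \subset P, (#|T| <= t)%N &
    #|[set w in W | nb adj w :&: T == set0]|%:R
      <= #|W|%:R * (1 - d%:R / (8 * N%:R)) ^+ t :> R].
Proof.
move=> d0 PN heavy; have [->|[w0 w0W]] := set_0Vmem W.
  exists set0; rewrite sub0set !cards0 mul0r (_ : [set w in _ | _] = set0) ?cards0 //.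
  by apply/setP => w; rewrite !inE.
have dN : (d <= 8 * N)%N.
  apply: leq_trans (heavy w0 w0W) _; rewrite leq_mul2l /=; apply: leq_trans PN.
  by apply: subset_leq_card; exact: subsetIr.
have N0 : 0 < 8 * N%:R :> R.
  by rewrite -natrM ltr0n (leq_trans d0).
have q0 : 0 <= 1 - d%:R / (8 * N%:R) :> R.
  by rewrite subr_ge0 ler_pdivrMr // mul1r -natrM ler_nat.
elim: t => [|t [T [TP Tt HT]]].
  exists set0; split; rewrite ?sub0set ?cards0 // expr0 mulr1 ler_nat.
  by apply: subset_leq_card; apply/subsetP => w; rewrite inE => /andP[].
set U := [set w in W | _] in HT.
have [U0|[w1 w1U]] := set_0Vmem U.
  exists T; split=> //; first exact: leqW.
  by rewrite -/U U0 cards0 mulr_ge0 // exprn_ge0.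
have [u uP hu] : exists2 u, u \in P & (#|U| * d <= 8 * N * #|nb adj u :&: U|)%N.
  apply/exists_inP; apply: contraT => /exists_inPn H; exfalso.
  have P0 : (0 < #|P|)%N.
    rewrite card_gt0; apply: contraTneq w0W => P0; apply/negP => /heavy.
    by rewrite P0 setI0 cards0 muln0 leqNgt d0.
  have lt : (8 * N * \sum_(u in P) #|nb adj u :&: U| + #|P| * 1 <= #|P| * (#|U| * d))%N.
    rewrite -[(#|P| * 1)%N]sum_nat_const -[(#|P| * (_ * _))%N]sum_nat_const.
    rewrite big_distrr -big_split /=; apply: leq_sum => u uP.
    by have := H u uP; rewrite -ltnNge addn1.
  have le : (#|U| * d <= 8 * \sum_(u in P) #|nb adj u :&: U|)%N.
    rewrite edge_count -[(#|U| * d)%N]sum_nat_const big_distrr /=; apply: leq_sum => w.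
    by rewrite inE => /andP[wW _]; exact: heavy.
  have := leq_mul PN le; lia.
exists (u |: T); split.
- by rewrite subUset sub1set uP.
- by rewrite cardsU1; case: (u \in T); rewrite /= ?add0n ?add1n ?ltnS // leqW.
rewrite (_ : [set w in W | _] = U :\: nb adj u); last first.
  apply/setP => w; rewrite !inE setIUr setU_eq0 [nb adj w :&: [set u]]setIC.
  by rewrite [X in _ && (X && _)]setI_eq0 disjoints1 inE adjC andbCA.
rewrite cardsD natrB ?subset_leq_card ?subsetIl // setIC.
have hu' : #|U|%:R * (d%:R / (8 * N%:R)) <= #|nb adj u :&: U|%:R :> R.
  by rewrite mulrA ler_pdivrMr // -!natrM ler_nat [leqRHS]mulnC.
rewrite exprSr mulrA; apply: (@le_trans _ _ (#|U|%:R * (1 - d%:R / (8 * N%:R)))); first by lra.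
by rewrite ler_wpM2r.
Qed.
End Cover.

Section PartialColourings.
Variables (R : realType) (V : finType).

Definition psupp (c : {ffun V -> option 'I_3}) : {set V} := [set v | c v != None].

(** Weight each coloured vertex by 1/x. A partial colouring that is counted has weight at least
    x^(-m), and the total weight factorises as (1 + 3/x)^|V|. *)
Lemma card_psupp_le (x : R) m : 1 <= x ->
  #|[set c | (#|psupp c| <= m)%N]|%:R <= x ^+ m * (1 + 3 / x) ^+ #|V|.
Proof.
move=> x1; have x0 : 0 < x by lra.
pose F (v : V) (o : option 'I_3) : R := if o is Some _ then x^-1 else 1.
have F0 v o : 0 <= F v o by rewrite /F; case: o => // _; rewrite invr_ge0 ltW.
have sumF v : \sum_o F v o = 1 + 3 / x.
  rewrite (bigD1 None) //= (eq_bigr (fun=> x^-1)); last by case.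
  by rewrite sumr_const cardC1 card_option card_ord -[_ *+ _]mulr_natl.
rewrite -[_ ^+ #|V|]prodr_const -(eq_bigr _ (fun v _ => sumF v)) bigA_distr_bigA mulr_sumr.
rewrite -sum1_card natr_sum [leLHS]big_mkcond /=; apply: ler_sum => c _.
have cE : \prod_v F v (c v) = x^-1 ^+ #|psupp c|.
  rewrite -prodr_const [RHS]big_mkcond; apply: eq_bigr => v _; rewrite inE /F.
  by case: (c v).
rewrite inE cE exprVn; case: ifP => cm; last by rewrite mulr_ge0 ?invr_ge0 ?exprn_ge0 // ltW.
by rewrite ler_pdivlMr ?exprn_gt0 // mul1r ler_weXn2l.
Qed.
End PartialColourings.

(** The three colours sum to 0 modulo 3, which gives the witness. *)
Lemma third_colour (i k : 'I_3) : i != k -> exists j, forall c, c != j -> c != k -> c = i.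
Proof.
move=> ik; exists (- (i + k))%R => c.
move: i k c ik => [[|[|[|?]]] ?] // [[|[|[|?]]] ?] // [[|[|[|?]]] ?] //= ik cj ck;
by apply/val_inj.
Qed.

Section Encoding.
Local Open Scope nat_scope.
Variables (V : finType) (adj : rel V) (side : pred V) (d : nat).
Hypothesis d_gt0 : (0 < d)%N.
Hypothesis adjC : symmetric adj.
Hypothesis adj_side : forall u v, adj u v -> side v = ~~ side u.
Hypothesis regular : forall v, #|nb adj v| = d.
Implicit Types (f g : {ffun V -> 'I_3}) (u v w : V) (i j : 'I_3) (c : {ffun V -> option 'I_3}).

Local Notation monochrome := (monochrome adj side).
Local Notation nearly_mono := (nearly_mono adj side d).

Lemma proper_neq f u v : proper_colouring adj f -> adj u v -> f u != f v.
Proof. by move=> /forallP/(_ u)/forallP/(_ v)/implyP. Qed.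

Definition even_class f i : {set V} := [set u | ~~ side u & f u == i].

(** A monochrome neighbourhood is all of one colour. Otherwise, since the colour of [w] is absent
    around it, the neighbours coloured [f u] are exactly the exceptions to the third colour, and
    there are more than d/8 of them. *)
Lemma heavy_nb f w u :
  proper_colouring adj f -> side w -> w \notin nearly_mono f -> u \in nb adj w ->
  (d <= 8 * #|nb adj w :&: even_class f (f u)|)%N.
Proof.
move=> pf ws wn uw.
have cls i : nb adj w :&: even_class f i = [set v in nb adj w | f v == i].
  apply/setP => v; rewrite !inE; case: (boolP (adj w v)) => //= /adj_side ->.
  by rewrite ws.
rewrite cls; have [/existsP[j /eqP exc0]|nomono] := boolP [exists i, exc adj f w i == 0%N].
  have allx v : v \in nb adj w -> f v = j.
    move=> vw; apply/eqP; move/eqP: exc0; rewrite cards_eq0 => /eqP/setP/(_ v).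
    by rewrite !inE; rewrite inE in vw; rewrite vw /= => /negbFE.
  rewrite (_ : [set v in _ | _] = nb adj w) ?regular; first by rewrite leq_pmull.
  apply/setP => v; rewrite inE; case: (boolP (v \in nb adj w)) => //= /allx ->.
  by rewrite allx ?eqxx.
have uk : f u != f w by rewrite eq_sym proper_neq //; rewrite inE in uw.
have [j Hj] := third_colour uk.
have ej : (exc adj f w j <= #|[set v in nb adj w | f v == f u]|)%N.
  apply/subset_leq_card/subsetP => v; rewrite !inE => /andP[vw vj].
  by rewrite vw /= (Hj _ vj) // eq_sym proper_neq.
apply: leq_trans (leq_mul (leqnn 8) ej); apply: ltnW; rewrite ltnNge; apply: contra wn => ne.
by rewrite !inE ws nomono /=; apply/existsP; exists j.
Qed.

(* A code [c] is the restriction of a colouring to a small set.  At an odd vertex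
   outside its domain the colours seen by [c] in the neighbourhood ([hit]) are
   exactly those of the colouring, which tells which of these vertices are
   monochrome ([decoded]) and restricts the colours of the others ([allowed]). *)
Definition hit c w : {set 'I_3} := [set i | [exists u in nb adj w, c u == Some i]].

Definition allowed c v : {set 'I_3} :=
  if side v then (if c v is Some i then [set i] else ~: hit c v)
  else [set i | [forall w in nb adj v, if c w is Some j then i != j else i \in hit c w]].

Definition decoded c : {set V} := [set w | [&& side w, c w == None & #|hit c w| == 1]].

Definition encodes c f : bool :=
  [forall v, if c v is Some i then f v == i else
     side v ==> (hit c v == f @: nb adj v)].

Lemma encodes_allowed c f : proper_colouring adj f -> encodes c f ->
  f \in family (allowed c).
Proof.
move=> pf /forallP E; apply/familyP => v; rewrite /allowed.
case: ifP => vs; have := E v.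
  case: (c v) => [i /eqP ->|]; first by rewrite inE.
  rewrite vs /= => /eqP ->; rewrite inE; apply/imsetP => -[u uv fvu].
  by have := proper_neq pf (u := v) (v := u); rewrite inE in uv; rewrite uv fvu eqxx => /(_ isT).
move=> _; rewrite inE; apply/forall_inP => w wv; have := E w.
have ws : side w by rewrite inE in wv; rewrite (adj_side wv) vs.
case: (c w) => [i /eqP <-|]; first by rewrite proper_neq //; rewrite inE in wv.
rewrite ws /= => /eqP ->; apply/imsetP; exists v => //.
by rewrite !inE adjC in wv *.
Qed.

(** The choices are counted vertex by vertex. A decoded vertex sees one colour, so it has two
    choices and its neighbours have one; every other uncoded vertex on [side] sees two colours and
    is forced. Any other vertex off [side] has at most two choices, since one neighbour already
    excludes a colour. The colouring [f] guarantees that [hit] is nonempty and misses [f w]. *)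
Lemma card_allowed c f : proper_colouring adj f -> encodes c f ->
  (#|family (allowed c)| <= 2 ^ (#|decoded c| + #|[set v | ~~ side v] :\: nbs adj (decoded c)|))%N.
Proof.
move=> pf /forallP E; set A := decoded c; set B := _ :\: _.
rewrite card_family foldrE big_map big_enum /=.
have -> : (2 ^ (#|A| + #|B|) = \prod_v if v \in A :|: B then 2 else 1)%N.
  rewrite -big_mkcond /= prod_nat_const cardsU (_ : A :&: B = set0) ?cards0 ?subn0 //.
  apply/setP => v; rewrite !inE; apply/negbTE/negP => /andP[/and3P[-> _ _]].
  by rewrite andbF.
have hitE w : side w -> c w = None -> hit c w = f @: nb adj w.
  by move=> ws cw; have := E w; rewrite cw ws /= => /eqP.
have nb0 w : exists u, u \in nb adj w.
  by apply/set0Pn; rewrite -card_gt0 regular.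
have hit_sub w : side w -> c w = None -> hit c w \subset ~: [set f w].
  move=> ws cw; rewrite hitE //; apply/subsetP => _ /imsetP[u uw ->].
  by rewrite !inE eq_sym proper_neq //; rewrite inE in uw.
have hit_gt0 w : side w -> c w = None -> (0 < #|hit c w|)%N.
  move=> ws cw; rewrite hitE // card_gt0; have [u uw] := nb0 w.
  by apply/set0Pn; exists (f u); apply: imset_f.
have cC1 i : #|~: [set i]| = 2 by rewrite cardsC1 card_ord.
elim/big_ind2: _ => // [x1 x2 y1 y2|v _]; first exact: leq_mul.
rewrite /allowed; case: ifP => vs.
  case Ec: (c v) => [i|].
    by rewrite cards1; case: ifP.
  have := hit_gt0 v vs Ec; rewrite [#|~: _|]cardsCs setCK card_ord.
  have vA : (v \in A) = (#|hit c v| == 1)%N by rewrite inE vs Ec.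
  rewrite in_setU vA; case: (#|hit c v|) => [|[|n]] //= _.
  by case: ifP => _; lia.
rewrite in_setU; have -> /= : (v \in A) = false by rewrite inE vs.
have -> : (v \in B) = (v \notin nbs adj A) by rewrite !inE vs andbT.
case: ifP => [vN|/negbFE]; last first.
  rewrite inE => /existsP[w /andP[wA wv]].
  move: (wA); rewrite inE => /and3P[ws /eqP cw /eqP h1].
  apply: (@leq_trans #|hit c w|); last by rewrite h1.
  apply/subset_leq_card/subsetP => i; rewrite inE => /forall_inP/(_ w).
  by rewrite cw inE adjC; apply.
have [w wv] := nb0 v; have ws : side w by rewrite inE in wv; rewrite (adj_side wv) vs.
case Ec: (c w) => [i|].
  apply: (@leq_trans #|~: [set i]|); last by rewrite cC1.
  apply/subset_leq_card/subsetP => j; rewrite !inE => /forall_inP/(_ w wv).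
  by rewrite Ec.
apply: (@leq_trans #|~: [set f w]|); last by rewrite cC1.
apply: leq_trans (subset_leq_card (hit_sub _ ws Ec)).
by apply/subset_leq_card/subsetP => j; rewrite inE => /forall_inP/(_ w wv); rewrite Ec.
Qed.

(** A monochrome vertex outside the domain of the code sees exactly one colour, hence is decoded. *)
Lemma decoded_bounds c f : encodes c f ->
  decoded c \subset monochrome f /\ (#|monochrome f| <= #|decoded c| + #|psupp c|)%N.
Proof.
move=> /forallP E; split.
  apply/subsetP => w; rewrite !inE => /and3P[ws /eqP cw /cards1P[i hi]].
  rewrite ws /=; apply/existsP; exists i; rewrite cards_eq0; apply/eqP/setP => u; rewrite !inE.
  apply/negbTE/negP => /andP[wu /eqP]; apply; apply/set1P; rewrite -hi.
  by have := E w; rewrite cw ws /= => /eqP ->; apply: imset_f; rewrite inE.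
rewrite -(cardsID (psupp c) (monochrome f)) addnC leq_add ?subset_leq_card ?subsetIr //.
apply/subsetP => w; rewrite !inE negbK => /andP[/eqP cw /andP[ws /existsP[i exc0]]].
rewrite ws cw eqxx /=; have := E w; rewrite cw ws /= => /eqP ->.
apply/cards1P; exists i; apply/setP => k; rewrite inE; apply/imsetP/eqP => [[u uw ->]|->].
  move: exc0; rewrite cards_eq0 => /eqP/setP/(_ u); rewrite !inE.
  by rewrite inE in uw; rewrite uw /= => /negbFE/eqP.
have /set0Pn[u uw] : nb adj w != set0 by rewrite -card_gt0 regular.
exists u => //; move: exc0; rewrite cards_eq0 => /eqP/setP/(_ u); rewrite !inE.
by rewrite inE in uw; rewrite uw /= => /negbFE/eqP.
Qed.

(** The code restricts [f] to a cover for each colour, the nearly monochrome vertices, and the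
    vertices missed by a cover. At any other vertex on [side], each colour seen occurs at least d/8
    times by [heavy_nb], so the cover for that colour exhibits it. *)
Lemma encoding_exists f t b :
  proper_colouring adj f ->
  (forall P W : {set V}, P \subset [set v | ~~ side v] -> W \subset [set v | side v] ->
     (forall w, w \in W -> (d <= 8 * #|nb adj w :&: P|)%N) ->
     exists T : {set V}, [/\ T \subset P, (#|T| <= t)%N &
       (#|[set w in W | nb adj w :&: T == set0]| <= b)%N]) ->
  exists2 c, encodes c f & (#|psupp c| <= 3 * t + #|nearly_mono f| + 3 * b)%N.
Proof.
move=> pf cover.
pose W i := [set w | side w & (d <= 8 * #|nb adj w :&: even_class f i|)%N].
have cov i : exists T : {set V}, [/\ T \subset even_class f i, (#|T| <= t)%N &
    (#|[set w in W i | nb adj w :&: T == set0]| <= b)%N].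
  apply: cover => [||w].
  - by apply/subsetP => u; rewrite !inE => /andP[].
  - by apply/subsetP => u; rewrite !inE => /andP[].
  - by rewrite inE => /andP[].
have [T HT] := fin_all_exists cov.
pose Bad i := [set w in W i | nb adj w :&: T i == set0].
have cU (F : 'I_3 -> {set V}) m : (forall i, (#|F i| <= m)%N) ->
    (#|[set v | [exists i, v \in F i]]| <= 3 * m)%N.
  move=> Fm; have <- : (\sum_(i < 3) m = 3 * m)%N by rewrite sum_nat_const card_ord.
  apply: (@leq_trans (\sum_i #|F i|)%N); last by apply: leq_sum.
  rewrite -sum1_card (eq_bigr (fun i => \sum_(v in F i) 1)%N); last by move=> i; rewrite sum1_card.
  rewrite (exchange_big_dep xpredT) //= [leqLHS]big_mkcond; apply: leq_sum => v _.
  rewrite inE; case: existsP => // -[i vi].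
  by rewrite sum1_card; apply/card_gt0P; exists i; rewrite unfold_in.
pose K := [set v | [exists i, v \in T i]] :|: nearly_mono f :|: [set v | [exists i, v \in Bad i]].
pose c : {ffun V -> option 'I_3} := [ffun v => if v \in K then Some (f v) else None].
exists c; last first.
  rewrite (_ : psupp c = K); last by apply/setP => v; rewrite inE ffunE; case: (v \in K).
  apply: leq_trans (leq_card_setU _ _) _; rewrite leq_add //; last first.
    by apply: cU => i; case: (HT i).
  by apply: leq_trans (leq_card_setU _ _) _; rewrite leq_add // cU // => i; case: (HT i).
apply/forallP => v; rewrite ffunE; case: ifP => vK; first by rewrite eqxx.
apply/implyP => vs; rewrite eqEsubset; apply/andP; split; apply/subsetP => i.
  rewrite inE => /existsP[u /andP[uv]]; rewrite ffunE; case: ifP => // _ /eqP[<-].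
  exact: imset_f.
case/imsetP => u uv ->; rewrite inE.
move: vK; rewrite 2!in_setU => /norP[/norP[_ vn]]; rewrite inE negb_exists => /forallP/(_ (f u)).
rewrite !inE vs heavy_nb //= => /set0Pn[x]; rewrite !inE => /andP[vx xT].
apply/existsP; exists x; rewrite inE vx /= ffunE ifT; last first.
  by rewrite !inE; apply/orP; left; apply/orP; left; apply/existsP; exists (f u).
by have [/subsetP/(_ _ xT)] := HT (f u); rewrite inE => /andP[_ /eqP ->].
Qed.

(** A code with decoded set A stands for at most 2^(|A| + |E| - |N(A)|) <= 2^(|E| - s) colourings.
    Decoding loses at most [m] monochrome vertices, so the size of A lies in the range where
    [expand] applies. *)
Lemma encode_count t b m0 m l1 l2 s :
  (forall P W : {set V}, P \subset [set v | ~~ side v] -> W \subset [set v | side v] ->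
     (forall w, w \in W -> (d <= 8 * #|nb adj w :&: P|)%N) ->
     exists T : {set V}, [/\ T \subset P, (#|T| <= t)%N &
       (#|[set w in W | nb adj w :&: T == set0]| <= b)%N]) ->
  (3 * t + m0 + 3 * b <= m)%N ->
  (forall A : {set V}, A \subset [set v | side v] -> (l1 <= #|A| + m)%N -> (#|A| <= l2)%N ->
     (#|A| + s <= #|nbs adj A|)%N) ->
  (#|[set f | [&& proper_colouring adj f, #|nearly_mono f| <= m0,
                  l1 <= #|monochrome f| & #|monochrome f| <= l2]]| * 2 ^ s
    <= #|[set c : {ffun V -> option 'I_3} | (#|psupp c| <= m)%N]|
       * 2 ^ #|[set v | ~~ side v]|)%N.
Proof.
move=> cover tm expand; set Om := [set f | _].
set Cd := [set c : {ffun V -> option 'I_3} | _]; set E := [set v | ~~ side v].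
pose S c := [set f in Om | encodes c f].
have OmS : (#|Om| <= \sum_(c in Cd) #|S c|)%N.
  rewrite (eq_bigr (fun c => \sum_(f in S c) 1)%N); last by move=> c; rewrite sum1_card.
  rewrite (exchange_big_dep (mem Om)) /=; last by move=> c f _; rewrite inE => /andP[].
  rewrite -sum1_card; apply: leq_sum => f fO.
  move: (fO); rewrite inE => /and4P[pf nf _ _].
  have [c cf cm] := encoding_exists pf cover.
  rewrite sum1_card; apply/card_gt0P; exists c.
  rewrite unfold_in /= [c \in Cd]inE [f \in S c]inE fO cf /= andbT.
  by apply: leq_trans tm; apply: leq_trans cm _; rewrite leq_add2r leq_add2l.
apply: leq_trans (leq_mul OmS (leqnn _)) _.
rewrite big_distrl /= -sum_nat_const; apply: leq_sum => c; rewrite inE => cm.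
have [->|[f]] := set_0Vmem (S c); first by rewrite cards0.
rewrite inE => /andP[fO cf]; move: fO; rewrite inE => /and4P[pf nf f1 f2].
have [Am mA] := decoded_bounds cf.
have Aside : decoded c \subset [set v | side v].
  by apply/subsetP => w; rewrite !inE => /and3P[].
have := expand _ Aside; set A := decoded c in Am mA *.
have lA : (l1 <= #|A| + m)%N.
  by apply: leq_trans f1 _; apply: leq_trans mA _; rewrite leq_add2l.
have hA : (#|A| <= l2)%N by apply: leq_trans (subset_leq_card Am) f2.
move=> /(_ lA hA) sA.
have Sle : (#|S c| <= 2 ^ (#|A| + #|E :\: nbs adj A|))%N.
  apply: leq_trans (card_allowed pf cf); apply/subset_leq_card/subsetP => g.
  rewrite inE => /andP[gO cg]; apply: encodes_allowed => //.
  by move: gO; rewrite inE => /andP[].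
apply: leq_trans (leq_mul Sle (leqnn _)) _; rewrite -expnD leq_exp2l //.
have NE : nbs adj A \subset E.
  apply/subsetP => u; rewrite !inE => /existsP[w /andP[wA /adj_side ->]].
  by have := subsetP Aside _ wA; rewrite inE => ->.
rewrite cardsD (setIidPr NE); have := subset_leq_card NE; lia.
Qed.
End Encoding.

(** * The two sides of the bottleneck *)

Section Phases.
Local Open Scope nat_scope.
Variables (V : finType) (adj : rel V) (side : pred V) (d : nat).
Hypothesis d_gt0 : (0 < d)%N.
Hypothesis adjC : symmetric adj.
Hypothesis adj_side : forall u v, adj u v -> side v = ~~ side u.
Hypothesis regular : forall v, #|nb adj v| = d.
Implicit Types (f g : {ffun V -> 'I_3}) (u v w : V) (i j : 'I_3).

Local Notation monochrome := (monochrome adj side).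
Local Notation O := [set v | side v].
Local Notation E := [set v | ~~ side v].

(* Colour 0 on one parity class, the other two colours free on the class [side v = b]. *)
Definition phase (b : bool) v : {set 'I_3} :=
  if side v == b then ~: [set ord0] else [set ord0].

Lemma phase_proper b f : f \in family (phase b) -> proper_colouring adj f.
Proof.
move=> /familyP fF; apply/forallP => u; apply/forallP => v; apply/implyP => /adj_side uv.
have := fF u; have := fF v; rewrite /phase uv.
case: (side u) b {fF} => -[] /=; rewrite !inE.
- by move/eqP ->.
- by move=> h /eqP ->; rewrite eq_sym.
- by move=> h /eqP ->; rewrite eq_sym.
- by move/eqP ->.
Qed.

Lemma card_phase b : #|family (phase b)| = (2 ^ #|[set v | side v == b]|)%N.
Proof.
rewrite card_family foldrE big_map big_enum /= -prod_nat_const [RHS]big_mkcond /=.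
by apply: eq_bigr => v _; rewrite inE /phase; case: ifP; rewrite ?cards1 // cardsC1 card_ord.
Qed.

Lemma phase_true_monochrome f : f \in family (phase true) -> monochrome f = O.
Proof.
move=> /familyP fF; apply/setP => w; rewrite !inE; case: (boolP (side w)) => //= ws.
apply/existsP; exists ord0; rewrite cards_eq0; apply/eqP/setP => u; rewrite !inE.
case: (boolP (adj w u)) => //= /adj_side us; have := fF u.
by rewrite /phase us ws inE => ->.
Qed.

(** Prescribing the colour of the [d] neighbours of [w] removes [d] binary choices. *)
Lemma card_phase_monochrome_at w i : side w ->
  (#|[set f in family (phase false) | exc adj f w i == 0]| * 2 ^ d <= 2 ^ #|E|)%N.
Proof.
move=> ws; pose L v := if v \in nb adj w then [set i] else phase false v.
have nbE : nb adj w \subset E.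
  by apply/subsetP => u; rewrite !inE => /adj_side ->; rewrite ws.
have sub : (#|[set f in family (phase false) | exc adj f w i == 0]| <= #|family L|)%N.
  apply/subset_leq_card/subsetP => f; rewrite inE => /andP[/familyP fF].
  rewrite cards_eq0 => /eqP/setP exc0; apply/familyP => v; rewrite /L.
  case: ifP => [vw|_]; last exact: fF.
  by have := exc0 v; rewrite !inE; rewrite inE in vw; rewrite vw /= => /negbFE.
apply: leq_trans (leq_mul sub (leqnn _)) _.
rewrite card_family foldrE big_map big_enum /=.
rewrite (_ : \prod_v #|L v| = 2 ^ #|E :\: nb adj w|)%N.
  rewrite -expnD cardsD (setIidPr nbE) regular subnK //.
  by rewrite -(regular w) subset_leq_card.
rewrite -prod_nat_const [RHS]big_mkcond /=; apply: eq_bigr => v _.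
rewrite /L /phase !inE; case: (adj w v) => /=; first by rewrite cards1.
by case: (side v); rewrite /= ?cards1 // cardsC1 card_ord.
Qed.

(** Markov's inequality: the average number of monochrome vertices in this phase is at most 3 |O| /
    2^d, and a heavy colouring has at least |O| / 2. *)
Lemma card_phase_heavy : (0 < #|O|)%N ->
  (#|[set f in family (phase false) | (#|O| <= 2 * #|monochrome f|)%N]| * 2 ^ d <= 6 * 2 ^ #|E|)%N.
Proof.
move=> O0; set B := [set f in _ | _].
rewrite -(leq_pmul2l O0).
have H : (#|O| * #|B| <= 2 * \sum_(w in O) \sum_i
    #|[set f in family (phase false) | exc adj f w i == 0%N]|)%N.
  apply: (@leq_trans (\sum_(f in B) 2 * #|monochrome f|)%N).
    by rewrite mulnC -sum_nat_const; apply: leq_sum => f; rewrite inE => /andP[].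
  rewrite -big_distrr leq_mul2l /=.
  rewrite (eq_bigr (fun f => \sum_(w in monochrome f) 1)%N); last by move=> f _; rewrite sum1_card.
  rewrite (exchange_big_dep (mem O)) /=; last by move=> f w _; rewrite !inE => /andP[].
  apply: leq_sum => w _; rewrite sum1_card.
  rewrite (eq_bigr (fun i =>
      \sum_(f in [set f in family (phase false) | exc adj f w i == 0%N]) 1)%N); last first.
    by move=> i _; rewrite sum1_card.
  rewrite (exchange_big_dep xpredT) //= -sum1_card [leqLHS]big_mkcond; apply: leq_sum => f _.
  rewrite unfold_in; case: ifP => // /andP[]; rewrite inE => /andP[fF _].
  rewrite inE => /andP[_ /existsP[i ei]].
  rewrite sum1_card; apply/card_gt0P; exists i.
  have fi : f \in [set f in family (phase false) | exc adj f w i == 0%N] by rewrite inE fF.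
  exact: fi.
rewrite mulnA; apply: leq_trans (leq_mul H (leqnn _)) _.
rewrite -mulnA big_distrl /=.
have -> : (#|O| * (6 * 2 ^ #|E|) = 2 * \sum_(w in O) \sum_(i < 3) 2 ^ #|E|)%N.
  by rewrite !sum_nat_const card_ord; lia.
rewrite leq_mul2l /=; apply: leq_sum => w; rewrite inE => ws.
by rewrite big_distrl /=; apply: leq_sum => i _; exact: card_phase_monochrome_at.
Qed.

(** Only the [d] neighbours of [v] can change status. *)
Lemma monochrome_recolour f g v :
  (forall u, u != v -> f u = g u) -> (#|monochrome f| <= #|monochrome g| + d)%N.
Proof.
move=> fg; rewrite -(cardsID (nb adj v) (monochrome f)) addnC leq_add //; last first.
  by rewrite -(regular v) subset_leq_card // subsetIr.
apply/subset_leq_card/subsetP => w; rewrite !in_setD => /andP[vw].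
rewrite (eq_nearly_mono side d (f := f) (g := g)) // => u; rewrite inE => wu; apply: fg.
by apply: contraNneq vw => <-; rewrite inE adjC.
Qed.

Local Notation colouring := (colouring3 adj).

Definition heavy_set : {set colouring} := [set chi | (#|O| <= 2 * #|monochrome (val chi)|)%N].

(** The number of monochrome vertices is within [d] of |O| / 2, written without division or
    truncated subtraction. *)
Definition bottleneck : {set {ffun V -> 'I_3}} :=
  [set f | [&& proper_colouring adj f, (#|O| <= 2 * (#|monochrome f| + d))%N &
             (2 * #|monochrome f| <= #|O| + 2 * d)%N]].

Lemma num_diff1_monochrome (chi1 chi2 : colouring) : num_diff chi1 chi2 = 1 ->
  (#|monochrome (val chi1)| <= #|monochrome (val chi2)| + d)%N.
Proof.
move=> /eqP/num_diff1P[v [_ E2]]; apply: (monochrome_recolour (v := v)) => u uv.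
by rewrite E2 ffunE (negbTE uv).
Qed.

(** Both the heavy set and its complement are covered, because either one may be the smaller
    half. *)
Lemma card_exit_boundary (R : realType) (A : {set colouring}) :
  A = heavy_set \/ A = ~: heavy_set ->
  (#|exit_boundary (@glauber R V adj) A| <= #|bottleneck|)%N.
Proof.
move=> AH; rewrite -(card_imset _ val_inj).
apply/subset_leq_card/subsetP => _ /imsetP[chi + ->].
rewrite inE => /andP[chiA /existsP[chi' /andP[chiA' P0]]].
have ne : chi != chi' by apply: contraNneq chiA' => <-.
have nd := glauber_neq0 ne P0.
have h1 := num_diff1_monochrome nd.
have h2 := num_diff1_monochrome (etrans (num_diffC _ _) nd).
rewrite inE (valP chi) /=; move: h1 h2 chiA chiA'; case: AH => ->; rewrite !inE /=; lia.
Qed.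

Lemma card_heavy_set : (2 ^ #|O| <= #|heavy_set|)%N.
Proof.
rewrite -(card_imset _ val_inj) -[#|O|](eq_card (A := [set v | side v == true])); last first.
  by move=> v; rewrite !inE eqb_id.
rewrite -card_phase; apply/subset_leq_card/subsetP => f fF; apply/imsetP.
exists (Sub f (phase_proper fF)); last by rewrite SubK.
by rewrite inE SubK phase_true_monochrome // leq_pmull.
Qed.

(** For [d >= 4] at most 6/16 of the colourings in the phase with [side] coloured 0 are heavy, so
    more than half of them are light. *)
Lemma card_light_set : (4 <= d)%N -> (0 < #|O|)%N -> (2 ^ #|E| <= 2 * #|~: heavy_set|)%N.
Proof.
move=> d4 O0; set B := [set f in family (phase false) | (#|O| <= 2 * #|monochrome f|)%N].
have hB := card_phase_heavy O0; rewrite -/B in hB.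
have cF : #|family (phase false)| = (2 ^ #|E|)%N.
  by rewrite card_phase; congr (2 ^ _)%N; apply: eq_card => v; rewrite !inE eqbF_neg.
have d16 : (16 <= 2 ^ d)%N by rewrite (@leq_exp2l 2 4).
have sub : (#|family (phase false)| <= #|B| + #|~: heavy_set|)%N.
  rewrite -(card_imset (mem (~: heavy_set)) val_inj); apply: leq_trans (leq_card_setU _ _).
  apply/subset_leq_card/subsetP => f fF; apply/setUP.
  have [h|h] := boolP (#|O| <= 2 * #|monochrome f|)%N; first by left; rewrite inE fF.
  right; apply/imsetP; exists (Sub f (phase_proper fF)); last by rewrite SubK.
  by rewrite !inE SubK.
have := leq_mul (leqnn #|B|) d16; lia.
Qed.
End Phases.

(** * Estimates *)

Section Estimates.
Variable R : realType.

Lemma expR1_ge2 : 2 <= expR 1 :> R.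
Proof. by apply: le_trans (expR_ge1Dx _); lra. Qed.

(** From 2 <= e follows 16^(1/d) <= e^(4/d), and from 3/4 <= e^(-1/4) follows (4/3)^m >= e^(m/4). *)
Lemma tail_estimate (c : R) (d N m : nat) :
  0 <= c -> (0 < d)%N -> c * (4 / 3) ^+ m <= ((2 ^+ (d + 4)) `^ d%:R^-1) ^+ N ->
  c <= 2 ^+ N * expR (4 * (N%:R / d%:R) - m%:R / 4).
Proof.
move=> c0 d0; have dR : 0 < d%:R :> R by rewrite ltr0n.
have -> : (2 ^+ (d + 4)) `^ d%:R^-1 = 2 * (2 ^+ 4) `^ d%:R^-1 :> R.
  by rewrite exprD powRM ?exprn_ge0 // -powR_mulrn // -powRrM mulfV ?powRr1 // lt0r_neq0.
have h16 : (2 ^+ 4) `^ d%:R^-1 <= expR (4 / d%:R) :> R.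
  rewrite expRM; apply: ge0_ler_powR; rewrite ?nnegrE ?exprn_ge0 ?expR_ge0 ?invr_ge0 //.
  by rewrite -[4 in leRHS]mulr1 expRM_natl lerXn2r ?nnegrE ?expR_ge0 // expR1_ge2.
have e4 : expR (m%:R / 4) <= (4 / 3) ^+ m :> R.
  rewrite expRM_natl lerXn2r ?nnegrE ?expR_ge0 ?divr_ge0 //.
  have h := @expR_ge1Dx R (- 4^-1); have e0 := @expR_gt0 R 4^-1.
  by rewrite expRN -(ler_pM2r e0) mulVf ?gt_eqF // in h; lra.
move=> H; rewrite expRD mulrA expRN ler_pdivlMr ?expR_gt0 //.
apply: le_trans (ler_wpM2l c0 e4) _; apply: le_trans H _.
rewrite exprMn ler_wpM2l ?exprn_ge0 // mulrCA expRM_natl.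
by rewrite lerXn2r ?nnegrE ?powR_ge0 ?expR_ge0.
Qed.

(** From 1/2 <= e^(-1/2) follows 2^s >= e^(s/2), and 1 + 3/d <= e^(3/d) handles the second factor of
    the bound on [K]. *)
Lemma encoding_estimate (c K : R) (d N m s : nat) :
  0 <= c -> (0 < d)%N -> c * 2 ^+ s <= K * 2 ^+ N ->
  K <= d%:R ^+ m * (1 + 3 / d%:R) ^+ (2 * N) ->
  c <= 2 ^+ N * expR (m%:R * ln d%:R + 6 * (N%:R / d%:R) - s%:R / 2).
Proof.
move=> c0 d0 cK KE; have dR : 0 < d%:R :> R by rewrite ltr0n.
have e2 : expR (s%:R / 2) <= 2 ^+ s :> R.
  rewrite expRM_natl lerXn2r ?nnegrE ?expR_ge0 //.
  have h := @expR_ge1Dx R (- 2^-1); have e0 := @expR_gt0 R 2^-1.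
  by rewrite expRN -(ler_pM2r e0) mulVf ?gt_eqF // in h; lra.
rewrite expRD mulrA expRN ler_pdivlMr ?expR_gt0 //.
apply: le_trans (ler_wpM2l c0 e2) _; apply: le_trans cK _.
rewrite mulrC ler_wpM2l ?exprn_ge0 //; apply: le_trans KE _.
rewrite expRD expRM_natl lnK ?posrE // ler_wpM2l ?exprn_ge0 //.
have -> : 6 * (N%:R / d%:R) = (2 * N)%:R * (3 / d%:R) :> R.
  by rewrite natrM; field; rewrite lt0r_neq0.
by rewrite expRM_natl lerXn2r ?nnegrE ?expR_ge0 ?addr_ge0 ?divr_ge0 ?expR_ge1Dx.
Qed.

Lemma sqrt_dim_gt1 (l r : R) : 1 <= l -> 2368 * l ^+ 2 <= r -> 1 < r.
Proof. by move=> *; nra. Qed.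

(* Here [l = ln d], [r = sqrt d], [y = N / d] and [x = N / (sqrt d ln d)]; [x / 32]
   is the threshold on nearly monochrome vertices, [8 y l + 1] the size of a greedy
   cover for one colour, and [y] the number of vertices that it misses. *)
Lemma bottleneck_arithmetic (y l r x m : R) :
  1 <= l -> 2368 * l ^+ 2 <= r -> r ^+ 2 <= y -> x * l = r * y ->
  m <= 3 * (8 * y * l + 1) + x / 32 + 3 * y ->
  [/\ 4 * y - x / 128 <= - (x / 256),
      m * l + 6 * y - (r * y / 8 - 1) / 2 <= - (x / 256) &
      r ^+ 2 + m <= r ^+ 2 * y / 4].
Proof.
move=> l1 rl ry xl mle.
have r1 : 2368 <= r by nra.
have y1 : 1 <= y by nra.
have x0 : 0 <= x by nra.
have xz : x <= r * y by nra.
have ll : 1 <= l ^+ 2 by nra.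
have lll : l <= l ^+ 2 by nra.
have yl2 : y <= y * l ^+ 2 by nra.
have yl : y * l <= y * l ^+ 2 by nra.
(* 2368 = 64 * 37: in the second bound all positive terms except x l / 32 add up to at most 37 y
   l^2, hence to at most r y / 64. *)
have main : 2368 * (y * l ^+ 2) <= r * y by nra.
split.
- have : 1024 * y * l <= x * l by rewrite xl; nra.
  by rewrite ler_pM2r; lra.
- have : m * l <= (3 * (8 * y * l + 1) + x / 32 + 3 * y) * l by rewrite ler_wpM2r //; lra.
  have -> : (3 * (8 * y * l + 1) + x / 32 + 3 * y) * l
     = 24 * (y * l ^+ 2) + 3 * l + (x * l) / 32 + 3 * (y * l) by field.
  rewrite xl; nra.
- have : r * y * 2368 <= r ^+ 2 * y by nra.
  have : y * l <= r * y by nra.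
  lra.
Qed.
End Estimates.

(** * The bottleneck in the hypercube is small *)

Section CubeBottleneck.
Variables (R : realType) (d : nat).
Hypothesis d_gt0 : (0 < d)%N.
Local Notation N := (2 ^ d.-1)%N.
Local Notation adj := (@cube_adj d).
Local Notation parity := (@parity d).

Lemma card_odd_cube : #|[set v | parity v]| = N.
Proof. by rewrite -(card_parity true d_gt0); apply: eq_card => v; rewrite !inE eqb_id. Qed.

Lemma card_even_cube : #|[set v | ~~ parity v]| = N.
Proof. by rewrite -(card_parity false d_gt0); apply: eq_card => v; rewrite !inE eqbF_neg. Qed.

(** With t >= 8 (N/d) ln d steps the greedy factor (1 - d/(8N))^t is at most 1/d, so at most N/d
    vertices are missed. *)
Lemma cube_cover (t b : nat) (P W : {set cube d}) :
  (d <= N)%N -> 8 * (N%:R / d%:R) * ln d%:R <= t%:R :> R -> N%:R / d%:R < b.+1%:R :> R ->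
  P \subset [set v | ~~ parity v] -> W \subset [set v | parity v] ->
  (forall w, w \in W -> (d <= 8 * #|nb adj w :&: P|)%N) ->
  exists T : {set cube d}, [/\ T \subset P, (#|T| <= t)%N &
    (#|[set w in W | nb adj w :&: T == set0]| <= b)%N].
Proof.
move=> dN tle ble PE WO heavy; have dR : 0 < d%:R :> R by rewrite ltr0n.
have PN : (#|P| <= N)%N by rewrite -card_even_cube subset_leq_card.
have WN : (#|W| <= N)%N by rewrite -card_odd_cube subset_leq_card.
have [T [TP Tt HT]] := @greedy_cover R _ adj (@cube_adjC d) P W d N t d_gt0 PN heavy.
exists T; split; [exact: TP|exact: Tt|].
rewrite -ltnS -(ltr_nat R); apply: le_lt_trans ble; apply: le_trans HT _.
have N0 : 0 < N%:R :> R by rewrite ltr0n expn_gt0.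
have q0 : 0 <= 1 - d%:R / (8 * N%:R) :> R.
  rewrite subr_ge0 ler_pdivrMr ?mulr_gt0 // mul1r -natrM ler_nat.
  by apply: leq_trans dN _; rewrite leq_pmull.
rewrite ler_pM ?exprn_ge0 ?ler_nat //.
rewrite -[d%:R in leRHS]lnK ?posrE // -expRN.
apply: (@le_trans _ _ (expR (- (d%:R / (8 * N%:R))) ^+ t)).
  by rewrite lerXn2r ?nnegrE ?expR_ge0 // expR_ge1Dx.
rewrite -expRM_natl ler_expR mulrN lerN2.
apply: (@le_trans _ _ (8 * (N%:R / d%:R) * ln d%:R * (d%:R / (8 * N%:R)))); last first.
  by rewrite ler_wpM2r ?divr_ge0 ?mulr_ge0 // ltW.
rewrite le_eqVlt; apply/orP; left; apply/eqP; field.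
by rewrite !lt0r_neq0.
Qed.

(** For densities between 1/4 and 3/4 the product of the density and its complement is at least
    3/16. *)
Lemma cube_expansion (s : nat) (A : {set cube d}) :
  Num.sqrt d%:R * s%:R <= 3 / 16 * N%:R :> R ->
  A \subset [set v | parity v] -> (N <= 4 * #|A|)%N -> (4 * #|A| <= 3 * N)%N ->
  (#|A| + s <= #|nbs adj A|)%N.
Proof.
move=> sle AO A1 A2; rewrite -(ler_nat R) natrD.
have iso := @nbs_parity_ge d R A d_gt0 AO; rewrite -natrX in iso.
have r0 : 0 < Num.sqrt d%:R :> R by rewrite sqrtr_gt0 ltr0n.
have N0 : 0 < N%:R :> R by rewrite ltr0n expn_gt0.
move: A1 A2; rewrite -!(ler_nat R) !natrM.
move: (#|nbs adj A|%:R) (#|A|%:R) (N%:R) (Num.sqrt d%:R) (s%:R) N0 r0 sle iso.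
move=> nA a n r k n0 r0 sle iso a1 a2; have {}iso : 3 / 16 * n <= r * (nA - a).
  apply: le_trans iso.
  have -> : a * (1 - a / n) = (a * (n - a)) / n by field; rewrite lt0r_neq0.
  by rewrite ler_pdivlMr //; nra.
by rewrite addrC -lerBrDr -(ler_pM2l r0); apply: le_trans iso.
Qed.

Lemma half_cube_even : (1 < d)%N -> N = (2 * N./2)%N.
Proof. by move=> d1; rewrite mul2n halfK oddX /= -subn1 subn_eq0 leqNgt d1 subn0. Qed.

Lemma card_bottleneck_split (m0 : nat) : (1 < d)%N ->
  (#|bottleneck adj parity d| <=
    #|[set f | proper_colouring adj f & (m0 < #|nearly_mono adj parity d f|)%N]| +
    #|[set f | [&& proper_colouring adj f, (#|nearly_mono adj parity d f| <= m0)%N,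
       (N./2 - d <= #|monochrome adj parity f|)%N &
       (#|monochrome adj parity f| <= N./2 + d)%N]]|)%N.
Proof.
move=> d1; have even_N := half_cube_even d1.
apply: leq_trans (leq_card_setU _ _); apply/subset_leq_card/subsetP => f.
rewrite inE card_odd_cube => /and3P[pf h1 h2]; apply/setUP.
have [h|h] := ltnP m0 #|nearly_mono adj parity d f|; first by left; rewrite inE pf.
right; rewrite inE pf h /=; move: even_N h1 h2; move: N./2 => k ->.
by move: #|monochrome _ _ _| => a h1 h2; apply/andP; split; lia.
Qed.

Lemma card_many_nearly_mono (m0 : nat) :
  #|[set f | proper_colouring adj f & (m0 < #|nearly_mono adj parity d f|)%N]|%:R <=
    2 ^+ N * expR (4 * (N%:R / d%:R) - m0.+1%:R / 4) :> R.
Proof.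
have H := @nearly_mono_count R _ adj parity d d_gt0 (@cube_adjC d) (@cube_adj_parity d)
  (@card_nb_cube d) m0.+1.
by rewrite card_odd_cube in H; exact: tail_estimate H.
Qed.

(** The decoded sets have between N/2 - d - m and N/2 + d elements; [4 * (d + m) <= N] keeps this
    between N/4 and 3N/4. Partial colourings are counted with weight [x = d]. *)
Lemma card_few_nearly_mono (t b m0 m s : nat) :
  (1 < d)%N -> 8 * (N%:R / d%:R) * ln d%:R <= t%:R :> R -> N%:R / d%:R < b.+1%:R :> R ->
  Num.sqrt d%:R * s%:R <= 3 / 16 * N%:R :> R ->
  (3 * t + m0 + 3 * b <= m)%N -> (4 * (d + m) <= N)%N ->
  #|[set f | [&& proper_colouring adj f, (#|nearly_mono adj parity d f| <= m0)%N,
     (N./2 - d <= #|monochrome adj parity f|)%N & (#|monochrome adj parity f| <= N./2 + d)%N]]|%:R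
  <= 2 ^+ N * expR (m%:R * ln d%:R + 6 * (N%:R / d%:R) - s%:R / 2) :> R.
Proof.
move=> d1 tle ble sle tm dmN; have even_N := half_cube_even d1.
have dN : (d <= N)%N by move: dmN; move: (N) => n; lia.
have cover P W := @cube_cover t b P W dN tle ble.
have H := @encode_count _ adj parity d d_gt0 (@cube_adjC d) (@cube_adj_parity d)
  (@card_nb_cube d) t b m0 m (N./2 - d)%N (N./2 + d)%N s cover tm.
have {}H := H _; rewrite card_even_cube -(ler_nat R) !natrM !natrX in H.
have KE := @card_psupp_le R (cube d) d%:R m _.
have {}KE := KE ltac:(by rewrite ler1n).
rewrite card_cube (_ : (2 ^ d = 2 * N)%N) in KE; last by rewrite -expnS prednK.
apply: (encoding_estimate _ d_gt0 (H _) KE) => //.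
move=> A AO A1 A2; apply: (cube_expansion sle AO).
  by move: even_N dmN A1 A2; move: N./2 (N) #|A| => k n a; lia.
by move: even_N dmN A1 A2; move: N./2 (N) #|A| => k n a; lia.
Qed.

Lemma card_bottleneck_cube (l r x : R) :
  ln d%:R = l -> Num.sqrt d%:R = r -> x = N%:R / (r * l) ->
  1 <= l -> 2368 * l ^+ 2 <= r -> (d ^ 2 <= N)%N ->
  #|bottleneck adj parity d|%:R <= 2 * 2 ^+ N * expR (- (x / 256)) :> R.
Proof.
move=> lE rE xE l1 r_ge dN; have dR : 0 < d%:R :> R by rewrite ltr0n.
have r2 : r ^+ 2 = d%:R by rewrite -rE sqr_sqrtr // ltW.
have r0 : 0 < r by rewrite -rE sqrtr_gt0.
have l0 : 0 < l by exact: lt_le_trans l1.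
have [y yE] : exists y : R, N%:R / d%:R = y by exists (N%:R / d%:R).
have Ny : N%:R = r ^+ 2 * y by rewrite r2 -yE mulrC divfK // lt0r_neq0.
have xl : x * l = r * y by rewrite xE -yE -r2; field; rewrite !lt0r_neq0.
have ry : r ^+ 2 <= y by rewrite r2 -yE ler_pdivlMr // -expr2 -natrX ler_nat.
have y0 : 0 <= y by rewrite -yE divr_ge0.
have x0 : 0 <= x by rewrite xE divr_ge0 // mulr_ge0 // ltW.
have nat_floor (z : R) : 0 <= z -> exists n : nat, n%:R <= z < n%:R + 1.
  by move=> z0; exists (Num.truncn z); rewrite natr1 truncn_itv.
have [m0 /andP[m0l m0g]] := nat_floor (x / 32) ltac:(by rewrite divr_ge0).
have [t /andP[tl tg]] := nat_floor (8 * y * l) ltac:(by rewrite !mulr_ge0 // ltW).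
have [b /andP[bl bg]] := nat_floor y y0.
(* With this choice r s <= r^2 y / 8 = N/8, below the 3N/16 that [cube_expansion] allows. *)
have [s /andP[sl sg]] := nat_floor (r * y / 8) ltac:(by rewrite divr_ge0 // mulr_ge0 // ltW).
have [m mE] : exists m, (3 * t.+1 + m0 + 3 * b)%N = m by exists (3 * t.+1 + m0 + 3 * b)%N.
have mle : m%:R <= 3 * (8 * y * l + 1) + x / 32 + 3 * y.
  rewrite -mE !natrD !natrM -[t.+1%:R]natr1; clear - tl m0l bl; lra.
have [num1 num2 num3] := bottleneck_arithmetic l1 r_ge ry xl mle.
have d1 : (1 < d)%N by rewrite -(ltr1n R) -r2 exprn_egt1 // (sqrt_dim_gt1 l1 r_ge).
have B1 := card_many_nearly_mono m0.
have B2 := @card_few_nearly_mono t.+1 b m0 m s d1.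
rewrite yE lE rE -[t.+1%:R]natr1 -[b.+1%:R]natr1 in B2.
rewrite yE -[m0.+1%:R]natr1 in B1.
have {}B2 := B2 (ltW tg) bg.
apply: (@le_trans _ _ (2 ^+ N * expR (- (x / 256)) + 2 ^+ N * expR (- (x / 256)))); last first.
  by rewrite -mulrDl -mulr2n -[2 ^+ N *+ 2]mulr_natl.
apply: le_trans (lerD (le_trans B1 _) (le_trans (B2 _ _ _) _)).
- by rewrite -natrD ler_nat card_bottleneck_split.
- rewrite ler_wpM2l ?exprn_ge0 // ler_expR; apply: le_trans num1.
  by rewrite lerD2l lerN2; lra.
- by rewrite Ny; clear - sl r0 y0; nra.
- by rewrite mE.
- by rewrite -(ler_nat R) natrM natrD -r2 Ny; clear - num3; lra.
rewrite ler_wpM2l ?exprn_ge0 // ler_expR; apply: le_trans num2.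
by rewrite lerD2l lerN2; clear - sg; lra.
Qed.
End CubeBottleneck.

Lemma sqr_le_exp2_pred d : (7 <= d)%N -> (d ^ 2 <= 2 ^ d.-1)%N.
Proof.
elim: d => // -[//|d] IH; rewrite leq_eqVlt => /orP[/eqP <- //|].
rewrite ltnS => d7; have {IH} := IH d7; rewrite /= (expnS 2 d).
by move: (2 ^ d)%N => k; nia.
Qed.

(** * Lower bounds for the mixing time on the hypercube *)

Section CubeMixing.
Variables (R : realType) (d : nat).
Local Notation adj := (@cube_adj d).
Local Notation tv t := (tv_dist (@glauber R _ adj) t (@uniform_dist R (colouring3 adj))).

Lemma cube_nb_ex (d0 : (0 < d)%N) (v : cube d) : exists u, adj v u.
Proof.
have /set0Pn[u uv] : nb adj v != set0 by rewrite -card_gt0 card_nb_cube.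
by exists u; rewrite inE in uv.
Qed.

(** This serves the finitely many small dimensions. The starting state is the 2-colouring by parity,
    which the chain keeps with probability at least 2/3. *)
Lemma cube_mixing_ge2 t : (2 <= d)%N -> tv t <= expR (-1) -> (2 <= t)%N.
Proof.
move=> d2; have d0 : (0 < d)%N by exact: ltnW.
pose f : {ffun cube d -> 'I_3} := [ffun v => if parity v then inord 1 else ord0].
have fp : proper_colouring adj f.
  apply/forallP => u; apply/forallP => v; apply/implyP => /cube_adj_parity uv.
  by rewrite !ffunE uv; case: (parity u) => /=; apply/eqP => /(congr1 val); rewrite /= inordK.
apply: (mixing_time_gt1 (@glauber_row R _ adj) (x := Sub f fp)).
- have := @card_heavy_set _ adj (@parity d) (@cube_adj_parity d).
  rewrite card_odd_cube // => h; apply: leq_trans (max_card _); apply: leq_trans h.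
  rewrite (@leq_exp2l 2 2) // -[2%N]expn1 leq_exp2l //; by rewrite -ltnS prednK.
- apply: glauber_diag_two_coloured => [v|v]; first exact: cube_nb_ex.
  rewrite SubK ffunE; case: ifP => _; apply/eqP => /(congr1 val) //=.
  by rewrite inordK.
Qed.

(** The smaller of the heavy set and its complement still has at least 2^(N-1) elements, against an
    exit boundary of at most 2^(N+1) e^(-x/256); hence t >= e^(x/256) / 40. *)
Lemma cube_mixing_ge t :
  let l : R := ln d%:R in let r : R := Num.sqrt d%:R in
  let x : R := (2 ^ d.-1)%:R / (r * l) in
  1 <= l -> 2368 * l ^+ 2 <= r -> (7 <= d)%N -> 512 * 39 <= x ->
  tv t <= expR (-1) -> expR (x / 512) <= t%:R.
Proof.
move=> l r x l1 rl d7 x_ge tvt; have d0 : (0 < d)%N by exact: leq_trans d7.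
have M := card_bottleneck_cube d0 (erefl l) (erefl r) (erefl x) l1 rl (sqr_le_exp2_pred d7).
set N := (2 ^ d.-1)%N in x x_ge M *.
pose H := heavy_set adj (@parity d).
have hH : (2 ^ N <= 2 * #|H|)%N.
  have := @card_heavy_set _ adj (@parity d) (@cube_adj_parity d).
  by rewrite card_odd_cube // -/N -/H; lia.
have hL : (2 ^ N <= 2 * #|~: H|)%N.
  have := @card_light_set _ adj (@parity d) d d0 (@cube_adj_parity d) (@card_nb_cube d).
  rewrite card_odd_cube // card_even_cube //; apply; first exact: leq_trans d7.
  by rewrite expn_gt0.
have cH := cardsC H.
have [A [AH A_half A_big]] : exists A, [/\ A = H \/ A = ~: H, (2 * #|A| <= #|colouring3 adj|)%N &
    (2 ^ N <= 2 * #|A|)%N].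
  have [h|h] := leqP (2 * #|H|) #|colouring3 adj|; first by exists H; split; [left| |].
  by exists (~: H); split; [right| |] => //; lia.
have := bottleneck_mixing (@glauber_ge0 R _ adj) (@glauber_row R _ adj)
  (@glauber_sym R _ adj) A_half tvt.
have := @card_exit_boundary _ adj (@parity d) d d0 (@cube_adjC d) (@card_nb_cube d) R A AH.
rewrite -(ler_nat R) => B1 B2.
have t0 : 0 <= t%:R :> R by [].
have P0 : 0 < 2 ^+ N :> R by rewrite exprn_gt0.
have A2 : 2 ^+ N <= 2 * #|A|%:R :> R by rewrite -natrX -natrM ler_nat.
have B3 := le_trans B2 (ler_wpM2l t0 (le_trans B1 M)).
have e0 := @expR_gt0 R (x / 512).
(* Half of the exponent absorbs the constant 40; this is why x >= 512 * 39 is assumed. *)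
have e39 : 40 <= expR (x / 512) by apply: le_trans (expR_ge1Dx _); lra.
have eN : expR (- (x / 256)) = (expR (x / 512) ^+ 2)^-1.
  by rewrite -expRM_natl -expRN; congr expR; field.
rewrite eN in B3; set e := expR _ in e0 e39 B3 *.
have : 2 ^+ N / 20 * e ^+ 2 <= t%:R * (2 * 2 ^+ N).
  rewrite -ler_pdivlMr ?exprn_gt0 //; apply: le_trans (le_trans _ B3) _; last by rewrite !mulrA.
  lra.
rewrite (_ : 2 ^+ N / 20 * e ^+ 2 = 2 ^+ N * (e ^+ 2 / 20)); last by rewrite mulrAC mulrA.
rewrite (_ : t%:R * (2 * 2 ^+ N) = 2 ^+ N * (2 * t%:R)); last by ring.
by rewrite ler_pM2l // => ?; nra.
Qed.
End CubeMixing.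

Lemma large_dimension (R : realType) (K : R) : 0 <= K ->
  exists d0 : nat, forall d : nat, (d0 <= d)%N ->
  let l : R := ln d%:R in let r : R := Num.sqrt d%:R in
  [/\ 1 <= l, 2368 * l ^+ 2 <= r, (7 <= d)%N & K <= (2 ^ d.-1)%:R / (r * l)].
Proof.
(* [l >= L] turns l^3 / 216 <= r into 2368 l^2 <= r; the summand [K] ensures [K <= d]. *)
move=> K0; pose L : R := 216 * 2368 + K.
exists (Num.truncn (expR L)).+1 => d dd l r.
have dL : expR L <= d%:R.
  have /andP[_ /ltW] := truncn_itv (expR_ge0 L); move/le_trans; apply.
  by rewrite ler_nat.
have L_le : L + 1 <= d%:R by rewrite addrC; apply: le_trans (expR_ge1Dx _) dL.
have dR : 0 < d%:R :> R by rewrite /L in L_le; lra.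
have d7 : (7 <= d)%N by rewrite -(ler_nat R); rewrite /L in L_le; lra.
have lL : L <= l by rewrite -[L]expRK ler_ln ?posrE ?expR_gt0.
have r2 : r ^+ 2 = d%:R by rewrite sqr_sqrtr // ltW.
have r0 : 0 < r by rewrite sqrtr_gt0.
have l0 : 0 <= l by apply: le_trans lL; rewrite /L; lra.
(* This is the sixth power of l/6 <= e^(l/6), since r^2 = d = e^l. *)
have rl : l ^+ 3 / 216 <= r.
  rewrite -ler_sqr ?nnegrE ?divr_ge0 ?exprn_ge0 ?(ltW r0) // r2 -[leRHS]lnK ?posrE // -/l.
  have -> : (l ^+ 3 / 216) ^+ 2 = (l / 6) ^+ 6 by field.
  have -> : expR l = expR (l / 6) ^+ 6 by rewrite -expRM_natl; congr expR; field.
  rewrite lerXn2r ?nnegrE ?divr_ge0 ?expR_ge0 //.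
  by apply: le_trans (expR_ge1Dx _); lra.
have l1 : 1 <= l by apply: le_trans lL; rewrite /L; lra.
have rl2 : 2368 * l ^+ 2 <= r.
  apply: le_trans rl; have : L * l ^+ 2 <= l * l ^+ 2 by rewrite ler_wpM2r ?exprn_ge0.
  have : 0 <= K * l ^+ 2 by rewrite mulr_ge0 ?exprn_ge0.
  by rewrite -exprS /L; lra.
split => //.
have lr : l <= r by apply: le_trans rl2; nra.
have rl0 : 0 < r * l by rewrite mulr_gt0 //; lra.
(* The quotient is at least [d], because r l <= r^2 = d and d^2 <= 2^(d-1). *)
rewrite ler_pdivlMr //; apply: (@le_trans _ _ (d%:R * d%:R)); last first.
  by rewrite -expr2 -natrX ler_nat sqr_le_exp2_pred.
have d_ge : K <= d%:R :> R by rewrite /L in L_le; lra.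
apply: ler_pM; [exact: K0|exact: ltW|exact: d_ge|].
by rewrite -r2 expr2 ler_pM2l.
Qed.

Theorem corollary1p5 (R : realType) :
  exists C : R, 0 < C /\
    forall d : nat, (2 <= d)%N ->
      ((exp2 (C * 2 ^+ d / (Num.sqrt d%:R * log2 d%:R)))%:E
         <= glauber_mixing_time R (@cube_adj d))%E.
Proof.
have [d0 large] := @large_dimension R (512 * 39) ltac:(lra).
have ln2_gt0 : 0 < ln 2 :> R by rewrite ln_gt0 // ltr1n.
have ln2_le1 : ln 2 <= 1 :> R by rewrite -[leRHS]expRK ler_ln ?posrE ?expR_gt0 // expR1_ge2.
(* The first bound serves large [d]: the exponent in base e is 2 C (ln 2)^2 x, at most x / 512. The
   second makes C 2^d <= 1 for [d] below the threshold. *)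
pose C : R := Num.min (2 ^- 10) (2 ^- d0).
have C0 : 0 < C by rewrite lt_min !invr_gt0 !exprn_gt0.
exists C; split=> // d d2; apply: le_ereal_inf_tmp => _ [t /= tvt <-]; rewrite lee_fin.
have dR : 0 < d%:R :> R by rewrite ltr0n ltnW.
have exp2E y : exp2 y = expR (y * ln 2) :> R by rewrite /exp2 /powR pnatr_eq0.
have [/large[l1 rl d7 xl]|/ltnW dd0] := leqP d0 d.
  apply: le_trans (cube_mixing_ge l1 rl d7 xl tvt); rewrite exp2E ler_expR.
  set l := ln d%:R in l1 xl *; set r := Num.sqrt _ in xl *.
  have x0 : 0 <= (2 ^ d.-1)%:R / (r * l) by apply: le_trans xl; lra.
  rewrite /log2 -/l; set x := _ / (r * l) in x0 *.
  have l0 : 0 < l by exact: lt_le_trans l1.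
  have r0 : 0 < r by rewrite sqrtr_gt0.
  have -> : C * 2 ^+ d / (r * (l / ln 2)) * ln 2 = 2 * C * (ln 2 ^+ 2) * x.
    rewrite /x natrX -{1}(prednK (ltnW d2)) exprS; field.
    by rewrite !lt0r_neq0.
  rewrite mulrC ler_wpM2l //.
  have C1 : C <= 2 ^- 10 by rewrite ge_min lexx.
  have C2 : C * (ln 2 ^+ 2) <= C * 1 by rewrite ler_wpM2l ?expr_le1 // ltW.
  have e10 : 2 ^- 10 * 1024 = 1 :> R.
    by rewrite -[1024]/((2 ^ 10)%:R) natrX mulVf // expf_neq0.
  lra.
(* Below the threshold the exponent is at most 1, so [2 <= t] suffices. *)
have t2 : 2 <= t%:R :> R by rewrite ler_nat; apply: cube_mixing_ge2 d2 tvt.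
apply: le_trans t2; rewrite /exp2 -[leRHS]powRr1 //.
have ln_d : ln 2 <= ln d%:R :> R by rewrite ler_ln ?posrE // ler_nat.
have log_ge1 : 1 <= log2 (d%:R : R) by rewrite /log2 ler_pdivlMr // mul1r.
have sqrt_ge1 : 1 <= Num.sqrt (d%:R : R).
  by rewrite -[leLHS]sqrtr1 ler_wsqrtr // ler1n ltnW.
rewrite ler_powR //; first by rewrite ler1n.
rewrite ler_pdivrMr; last by apply: mulr_gt0; apply: lt_le_trans ltr01 _.
apply: (@le_trans _ _ 1); last by rewrite mul1r mulr_ege1.
apply: (@le_trans _ _ (2 ^- d0 * 2 ^+ d)).
  by rewrite ler_wpM2r ?exprn_ge0 // ge_min lexx orbT.
by rewrite mulrC ler_pdivrMr ?exprn_gt0 // mul1r ler_weXn2l // ler1n.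
Qed.
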